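(* Let $1\le q\le r<\infty$ and $1\le s<\infty$. Assume that $T$ is a sublinear operator of weak type $(q,q)$, and that the bi-sublinear maximal operator $\mathscr M_T$ maps $L^r\times L^s$ into $L^{\nu,\infty}$, where $\frac1\nu=\frac1r+\frac1s$. Then, for every compactly supported $f\in L^r(\mathbb R^n)$ and every $g\in L^s_{loc}(\mathbb R^n)$, there exists a $\frac{1}{2\cdot 3^n}$-sparse family $\mathcal S$ of cubes such that $$|\langle Tf,g\rangle|\le K\sum_{Q\in\mathcal S}\langle f\rangle_{r,Q}\langle g\rangle_{s,Q}|Q|,$$ where $$K=C_n\big(\|T\|_{L^q\to L^{q,\infty}}+\|\mathscr M_T\|_{L^r\times L^s\to L^{\nu,\infty}}\big)$$ and $C_n$ depends only on $n$.
   Context: Cubes in $\mathbb R^n$ have sides parallel to the axes; $3Q$ is the cube with the same center as $Q$ and three times its sidelength; $|E|$ is Lebesgue measure. $\langle F,g\rangle=\int_{\mathbb R^n}Fg\,dx$ and $\langle f\rangle_{p,Q}=\big(\frac1{|Q|}\int_Q|f|^p\big)^{1/p}$. For an operator $T$, $$\mathscr M_T(f,g)(x)=\sup_{Q\ni x}\frac1{|Q|}\int_Q|T(f\chi_{\mathbb R^n\setminus 3Q})|\,|g|\,dy,$$ the supremum being over all cubes $Q\subset\mathbb R^n$ containing $x$. A family $\mathcal S$ of cubes is $\eta$-sparse, $0<\eta\le1$, if for every $Q\in\mathcal S$ there is a measurable set $E_Q\subset Q$ with $|E_Q|\ge\eta|Q|$, and the sets $\{E_Q\}_{Q\in\mathcal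 S}$ are pairwise disjoint. For $0<p<\infty$, $\|F\|_{L^{p,\infty}}=\sup_{\alpha>0}\alpha|\{|F|>\alpha\}|^{1/p}$. $T$ is of weak type $(q,q)$ if $\|T\|_{L^q\to L^{q,\infty}}<\infty$, this being the smallest $C$ with $\|Tf\|_{L^{q,\infty}}\le C\|f\|_{L^q}$ for all $f\in L^q$. $\|\mathscr M_T\|_{L^r\times L^s\to L^{\nu,\infty}}$ is the smallest $C$ with $\|\mathscr M_T(f,g)\|_{L^{\nu,\infty}}\le C\|f\|_{L^r}\|g\|_{L^s}$ for all $f\in L^r$, $g\in L^s$. *)

(* Defs.v *)
From HB Require Import structures.
From mathcomp Require Import all_boot all_order all_algebra.
From mathcomp Require Import all_classical all_reals all_analysis.
Set Implicit Arguments.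
Unset Strict Implicit.
Unset Printing Implicit Defensive.
Import Order.TTheory GRing.Theory Num.Theory.
Import numFieldNormedType.Exports.
Local Open Scope classical_set_scope.
Local Open Scope ring_scope.

(* Throughout, the ambient dimension is [n.+1] >= 1 and points of R^(n+1) are
   row vectors ['rV[R]_n.+1], with the topology given by the library. *)

Section lebesgue_measure_on_row_vectors.
Context (R : realType) (n : nat).
Implicit Types (a b : 'rV[R]_n.+1) (A : set 'rV[R]_n.+1).

Definition box (ab : 'rV[R]_n.+1 * 'rV[R]_n.+1) : set 'rV[R]_n.+1 :=
  [set x | forall i, ab.1 ord0 i <= x ord0 i < ab.2 ord0 i].

(* The truncation at 0 gives volume 0 to an empty box. *)
Definition box_vol (ab : 'rV[R]_n.+1 * 'rV[R]_n.+1) : R :=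
  \prod_(i < n.+1) Num.max 0 (ab.2 ord0 i - ab.1 ord0 i).

Definition box_cover A : set (nat -> 'rV[R]_n.+1 * 'rV[R]_n.+1) :=
  [set B | A `<=` \bigcup_k box (B k)].

Definition leb_outer A : \bar R :=
  ereal_inf [set (\sum_(0 <= k <oo) (box_vol (B k))%:E)%E | B in box_cover A].

Lemma box_vol_ge0 ab : 0 <= box_vol ab.
Proof. by apply: prodr_ge0 => i _; rewrite le_max lexx. Qed.

Let leb_outer_ge0 A : (0 <= leb_outer A)%E.
Proof.
apply: le_ereal_inf_tmp => _ [B _ <-].
by apply: nneseries_ge0 => k _ _; rewrite lee_fin box_vol_ge0.
Qed.

Let leb_outer0 : leb_outer set0 = 0%E.
Proof.
apply/eqP; rewrite eq_le leb_outer_ge0 andbT.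
apply: ereal_inf_lbound; exists (fun=> (0, 0)); first exact: sub0set.
apply: eseries0 => k _ _.
by rewrite /box_vol big_ord_recl /= subrr maxxx mul0r.
Qed.

Let le_leb_outer : {homo leb_outer : A B / A `<=` B >-> (A <= B)%E}.
Proof.
move=> A B AB; apply/ereal_inf_le_tmp => _ [C BC <-].
by exists C => //; exact: subset_trans AB BC.
Qed.

Let leb_outer_sigma_subadditive : sigma_subadditive leb_outer.
Proof.
move=> A; have [[i ioo]|] := pselect (exists i, leb_outer (A i) = +oo%E).
  rewrite (eseries_pinfty _ _ ioo) ?leey// => k _.
  by rewrite -ltNye (lt_le_trans _ (leb_outer_ge0 _)).
rewrite -forallNE => Aoo.
apply/lee_addgt0Pr => e e0.
rewrite (le_trans _ (epsilon_trick _ _ (ltW e0)))//.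
pose P k B := box_cover (A k) B /\
  (\sum_(0 <= j <oo) (box_vol (B j))%:E
     <= leb_outer (A k) + (e / (2 ^ k.+1)%:R)%:E)%E.
have [G PG] : {G & forall k, P k (G k)}.
  apply: (@choice _ _ P) => k.
  have e2 : 0 < e / (2 ^ k.+1)%:R by rewrite divr_gt0// ltr0n expn_gt0.
  have Afin : leb_outer (A k) \is a fin_num.
    by rewrite ge0_fin_numE// ltey; apply/eqP; exact: Aoo.
  have [_ [B AB <-] Bx] := lb_ereal_inf_adherent e2 Afin.
  by exists B; split => //; exact/ltW.
have vol_ge0 x : (0 <= (box_vol (uncurry G x))%:E)%E.
  by rewrite lee_fin box_vol_ge0.
have /card_esym/ppcard_eqP[f] := card_nat2.
apply: (@le_trans _ _ (\esum_(i in setT) (box_vol (uncurry G i))%:E)%E).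
  apply: ereal_inf_lbound; exists (uncurry G \o f).
    move=> x [k _ Akx]; have [j _ Gx] := (PG k).1 x Akx.
    by exists (f^-1%FUN (k, j)) => //=; rewrite invK ?inE.
  rewrite -(esum_pred_image (fun i => (box_vol (uncurry G i))%:E) _ xpredT)
    ?[fun=> _]set_true//.
  by rewrite image_eq.
have -> : (\esum_(i in setT) (box_vol (uncurry G i))%:E
    = \sum_(0 <= k <oo) \sum_(0 <= j <oo) (box_vol (G k j))%:E)%E.
  pose J : nat -> set (nat * nat) := fun i => [set (i, j) | j in setT].
  rewrite (_ : setT = \bigcup_k J k); last first.
    by rewrite predeqE => -[u v]; split => // _; exists u => //; exists v.
  rewrite esum_bigcupT /=; last 2 first.
  - apply/trivIsetP => i j _ _ ij.
    rewrite predeqE => -[u v] /=; split => //= -[] [_] _ [<-{u} _].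
    by move=> [m' _] [] /esym/eqP; rewrite (negbTE ij).
  - by move=> *.
  rewrite -nneseries_esumT; last by move=> k; exact: esum_ge0.
  congr (limn _); apply/funext => m; apply: eq_bigr => k _.
  rewrite esum_image//=; last by move=> ? ? _ _ [].
  by rewrite nneseries_esumT// => j; exact: (vol_ge0 (k, j)).
apply: lee_nneseries => [k _ _|k _]; last exact: (PG k).2.
by apply: nneseries_ge0 => j _ _; rewrite lee_fin box_vol_ge0.
Qed.

HB.instance Definition _ := isOuterMeasure.Build R 'rV[R]_n.+1 leb_outer
  leb_outer0 leb_outer_ge0 le_leb_outer leb_outer_sigma_subadditive.

End lebesgue_measure_on_row_vectors.

(* R^(n+1) with the sigma-algebra of all Lebesgue measurable sets. *)
Definition Rn (R : realType) (n : nat) : measurableType (@leb_outer R n).-cara :=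
  caratheodory_type (@leb_outer R n).

Section leb.
Context (R : realType) (n : nat).

Definition leb : set (Rn R n) -> \bar R := @leb_outer R n.

Let leb0 : leb set0 = 0%E.
Proof. exact: caratheodory_measure0. Qed.

Let leb_ge0 A : (0 <= leb A)%E.
Proof. exact: caratheodory_measure_ge0. Qed.

Let leb_semi_sigma_additive : semi_sigma_additive leb.
Proof. exact: caratheodory_measure_sigma_additive. Qed.

HB.instance Definition _ := isMeasure.Build _ (Rn R n) R leb
  leb0 leb_ge0 leb_semi_sigma_additive.

End leb.
Arguments leb R n : clear implicits.

Section harmonic_analysis.
Context (R : realType) (n : nat).
Implicit Types (f g : Rn R n -> R) (p : R) (T : (Rn R n -> R) -> Rn R n -> R).
Local Notation mu := (leb R n).
Local Notation cube_data := ('rV[R]_n.+1 * R)%type.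
Implicit Types (Q : cube_data) (S : set cube_data).

(* A pair [Q] encodes the cube with center [Q.1] and sidelength [Q.2]. Cubes are
   taken open, so that the level sets of the maximal operator below are open;
   adding boundary points changes neither the averages nor the norms. *)
Definition is_cube Q := 0 < Q.2.

Definition cube Q : set (Rn R n) :=
  [set x | forall i, `|(x : 'rV[R]_n.+1) ord0 i - Q.1 ord0 i| < Q.2 / 2].

Definition triple Q : cube_data := (Q.1, 3 * Q.2).

Definition avg p f Q : \bar R :=
  (((mu (cube Q))^-1 * \int[mu]_(x in cube Q) (`|f x| `^ p)%:E) `^ p^-1)%E.

Definition sparse (eta : R) S :=
  (forall Q, S Q -> is_cube Q) /\
  exists E : cube_data -> set (Rn R n),
    (forall Q, S Q -> [/\ measurable (E Q), E Q `<=` cube Q &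
      (eta%:E * mu (cube Q) <= mu (E Q))%E]) /\
    trivIset S E.

Definition Lp_loc p g :=
  measurable_fun setT g /\
  forall K : set 'rV[R]_n.+1, compact K ->
    (\int[mu]_(x in (K : set (Rn R n))) (`|g x| `^ p)%:E < +oo)%E.

(* Functions are only relevant up to null sets, whence the essential support. *)
Definition compactly_supported f :=
  exists2 K : set 'rV[R]_n.+1, compact K &
    {ae mu, forall x : Rn R n, ~ K x -> f x = 0}.

Definition weak_norm p (F : Rn R n -> \bar R) : \bar R :=
  ereal_sup [set (alpha%:E * mu [set x | alpha%:E < `|F x|] `^ p^-1)%E
            | alpha in [set alpha : R | 0 < alpha]].

Definition linear_class (D : set (Rn R n -> R)) :=
  [/\ D (cst 0),
      forall f g, D f -> D g -> D (f \+ g) &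
      forall (c : R) f, D f -> D (c \*o f)].

(* [D] is the domain of [T]; the values of [T] outside [D] are irrelevant. *)
Definition sublinear_operator (D : set (Rn R n -> R)) T :=
  [/\ linear_class D,
      forall f, D f -> measurable_fun setT (T f),
      forall f g, D f -> D g ->
        {ae mu, forall x, `|T (f \+ g) x| <= `|T f x| + `|T g x|} &
      forall (c : R) f, D f ->
        {ae mu, forall x, `|T (c \*o f) x| = `|c| * `|T f x|}].

(* The infimum is +oo when no constant is admissible. *)
Definition weak_type_norm (q : R) T : \bar R :=
  ereal_inf [set C%:E | C in [set C : R | 0 <= C /\
    forall f, f \in Lfun mu q%:E ->
      (weak_norm q (EFin \o T f) <= C%:E * 'N[mu]_q%:E[EFin \o f])%E]].

Definition weak_type (q : R) T := (weak_type_norm q T < +oo)%E.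

Definition maximal_operator T f g (x : Rn R n) : \bar R :=
  ereal_sup [set ((mu (cube Q))^-1 * \int[mu]_(y in cube Q)
                    (`|T (f \* \1_(~` cube (triple Q))) y| * `|g y|)%:E)%E
            | Q in [set Q | is_cube Q /\ cube Q x]].

Definition maximal_operator_norm (r s nu : R) T : \bar R :=
  ereal_inf [set C%:E | C in [set C : R | 0 <= C /\
    forall f g, f \in Lfun mu r%:E -> g \in Lfun mu s%:E ->
      (weak_norm nu (maximal_operator T f g)
         <= C%:E * 'N[mu]_r%:E[EFin \o f] * 'N[mu]_s%:E[EFin \o g])%E]].

Definition pairing (F g : Rn R n -> R) : \bar R := \int[mu]_x (F x * g x)%:E.

End harmonic_analysis.

(* Main.v *)
Require Import Defs.
From mathcomp Require Import all_boot all_order all_algebra.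
From mathcomp Require Import all_classical all_reals all_analysis.
From mathcomp Require Import measurable_realfun.
From mathcomp Require Import ring lra.
Import Order.TTheory GRing.Theory Num.Theory.
Import numFieldNormedType.Exports.
Set Implicit Arguments.
Unset Strict Implicit.
Unset Printing Implicit Defensive.
Local Open Scope classical_set_scope.
Local Open Scope ring_scope.

(** Tripling cubes, the theorem follows from a local statement iterated
    infinitely often. Fix a cube [Q] and let [f_Q] be the restriction of [f] to
    [3 Q]. By the weak type bounds the set where [|T f_Q|] exceeds a large
    multiple of [||T|| <f>_{r,3Q}], or where [M_T (f_Q, g 1_Q)] exceeds a large
    multiple of [||M_T|| <f>_{r,3Q} <g>_{s,Q}], has small measure compared with
    [Q] ([T_level], which also passes from exponent [q] to [r] by Jensen, and
    [M_level]). Enlarge it to an open set [O] and let the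
    children [P] of [Q] be the maximal dyadic subcubes in which [O] has density
    above a dimensional threshold ([stopping_cubesP]). They cover [O], fill at
    most half of [Q], and each contains a point outside [O]. Away from the
    children [|T f_Q|] is below its level. On a child [P],
    [|T f_Q| <= |T (f_Q 1_{R^n \ 3P})| + |T f_P|], and the integral over [P] of
    the first term against [|g|] is an average appearing in [M_T], bounded by
    the value of [M_T] at a point of [P] outside [O]. So the integral of
    [|T f_Q| |g|] over [Q] is at most
    [C (||T|| + ||M_T||) <f>_{r,3Q} <g>_{s,Q} |Q|] plus the sum over the
    children of the same integrals for [P] ([local_step_holds]).

    Iterating ([sparse_domination]) gives all the descendants of [Q]; the part
    of a cube outside its children makes them 1/2-sparse. The remainder after
    [N] steps need not tend to 0 as a sum of integrals of [|T f_P| |g|]. The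
    iteration therefore estimates the integral of [|T f_Q| |g|] only over the
    part of [Q] outside the cubes of generation [N]; the complements of these
    parts have measure at most [2^-N |Q|], and monotone convergence finishes.

    Since [f] has compact support, space is partitioned into cubes [Q] whose
    triples contain the support: a central cube and, around it, shells of cubes
    that grow by a factor 3 ([root_cubes]). On each of them [|T f| <= |T f_Q|]
    almost everywhere. Summing the local results over this partition and
    replacing every cube by its triple gives the theorem; tripling turns
    1/2-sparse into [1 / (2 3^n)]-sparse.

    The measure enters only through the homogeneity of cubes ([leb_cube]), open
    hulls ([open_hull]) and countable additivity. The volume of the unit cube
    stays an unknown constant, and were it 0 the measure would vanish
    altogether. The dimension is [n.+1] in the code and [n] above. *)

(** * Lebesgue measure of boxes and cubes *)

Section lebesgue_measure_geometry.
Context {R : realType} {n : nat}.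
Local Notation V := 'rV[R]_n.+1.
Local Notation mu := (leb R n).
Local Notation cube_data := ('rV[R]_n.+1 * R)%type.
Implicit Types (a b v x y : V) (Q P : cube_data) (A : set V).

Lemma leb_outer_cover A (B : nat -> V * V) : A `<=` \bigcup_k box (B k) ->
  (leb_outer A <= \sum_(0 <= k <oo) (box_vol (B k))%:E)%E.
Proof. by move=> AB; apply: ereal_inf_lbound; exists B. Qed.

Lemma box_vol00 : box_vol (0 : V, 0 : V) = 0.
Proof. by rewrite /box_vol big_ord_recl /= subrr maxxx mul0r. Qed.

Lemma leb_outer_box ab : (@leb_outer R n (box ab) <= (box_vol ab)%:E)%E.
Proof.
pose B k : V * V := if k == 0%N then ab else (0, 0).
apply: (le_trans (leb_outer_cover (B := B) _)); first by move=> x xab; exists 0%N.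
rewrite nneseries_recl//; last by move=> k _; rewrite lee_fin box_vol_ge0.
rewrite eseries0 ?adde0// => -[//|k] _ _.
by rewrite /B /= box_vol00.
Qed.

(** Caratheodory's criterion for a half-space, tested on a single box of a
    cover: both pieces of the box are boxes again. *)
Lemma box_vol_split a b (i : 'I_n.+1) (t : R) :
  box_vol (a, \row_j (if j == i then Num.min (b ord0 i) t else b ord0 j)) +
  box_vol (\row_j (if j == i then Num.max (a ord0 i) t else a ord0 j), b)
    <= box_vol (a, b).
Proof.
set b' := (X in box_vol (a, X) + _); set a' := (X in _ + box_vol (X, b)).
rewrite /box_vol (bigD1 i)//= [X in _ + X](bigD1 i)//=.
rewrite [leRHS](bigD1 i)//= !mxE eqxx.
have eqb : \prod_(j < n.+1 | j != i) Num.max 0 (b' ord0 j - a ord0 j) =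
    \prod_(j < n.+1 | j != i) Num.max 0 (b ord0 j - a ord0 j).
  by apply: eq_bigr => j ji; rewrite mxE (negbTE ji).
have eqa : \prod_(j < n.+1 | j != i) Num.max 0 (b ord0 j - a' ord0 j) =
    \prod_(j < n.+1 | j != i) Num.max 0 (b ord0 j - a ord0 j).
  by apply: eq_bigr => j ji; rewrite mxE (negbTE ji).
rewrite eqb eqa -mulrDl ler_wpM2r//.
  by apply: prodr_ge0 => j _; rewrite le_max lexx.
rewrite /Num.min /Num.max.
by repeat case: ifP; move=> *; lra.
Qed.

Lemma measurable_halfspace (i : 'I_n.+1) (t : R) :
  measurable ([set x : V | x ord0 i < t] : set (Rn R n)).
Proof.
apply: le_caratheodory_measurable => X.
apply: le_ereal_inf_tmp => _ [B XB <-].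
pose B1 k : V * V := ((B k).1,
  \row_j (if j == i then Num.min ((B k).2 ord0 i) t else (B k).2 ord0 j)).
pose B2 k : V * V :=
  (\row_j (if j == i then Num.max ((B k).1 ord0 i) t else (B k).1 ord0 j),
   (B k).2).
apply: (@le_trans _ _ (\sum_(0 <= k <oo) (box_vol (B1 k))%:E +
                       \sum_(0 <= k <oo) (box_vol (B2 k))%:E)%E).
  apply: leeD; apply: leb_outer_cover => x [Xx /= xt];
    have [k _ Bx] := XB x Xx; exists k => // j; rewrite /= mxE;
    case: eqP => [->|_]; have := Bx j; have := Bx i; try by [].
  - by rewrite lt_min xt andbT.
  - by rewrite ge_max => /andP[-> ->] _; rewrite andbT leNgt; apply/negP.
rewrite -nneseriesD; try by move=> k _ _; rewrite lee_fin box_vol_ge0.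
apply: lee_nneseries => k _ *; rewrite -?EFinD lee_fin.
  by rewrite addr_ge0 ?box_vol_ge0.
by rewrite [X in _ <= box_vol X]surjective_pairing; exact: box_vol_split.
Qed.

Lemma measurable_halfspace_ge (i : 'I_n.+1) (t : R) :
  measurable ([set x : V | t <= x ord0 i] : set (Rn R n)).
Proof.
rewrite (_ : mkset _ = ~` [set x : V | x ord0 i < t]).
  by apply: measurableC; exact: measurable_halfspace.
by apply/seteqP; split => x /=; rewrite leNgt => /negP.
Qed.

Lemma measurable_halfspace_le (i : 'I_n.+1) (t : R) :
  measurable ([set x : V | x ord0 i <= t] : set (Rn R n)).
Proof.
rewrite (_ : mkset _ = \bigcap_k [set x : V | x ord0 i < t + k.+1%:R^-1]).
  by apply: bigcap_measurable => // k _; exact: measurable_halfspace.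
apply/seteqP; split => x /= xt; first by move=> k _ /=; rewrite ltr_pwDr.
rewrite leNgt; apply/negP => tx.
have x0 : 0 < x ord0 i - t by rewrite subr_gt0.
have [k] := ltr_add_invr tx.
by have /= := xt k I; rewrite ltNge => /negP; move=> + /ltW.
Qed.

Lemma measurable_halfspace_gt (i : 'I_n.+1) (t : R) :
  measurable ([set x : V | t < x ord0 i] : set (Rn R n)).
Proof.
rewrite (_ : mkset _ = ~` [set x : V | x ord0 i <= t]).
  by apply: measurableC; exact: measurable_halfspace_le.
by apply/seteqP; split => x /=; rewrite ltNge => /negP.
Qed.

Lemma measurable_coordinatewise (F : 'I_n.+1 -> set (Rn R n)) :
  (forall i, measurable (F i)) -> measurable [set x | forall i, F i x].
Proof.
move=> mF; rewrite (_ : mkset _ = \bigcap_(i in [set: 'I_n.+1]) F i).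
  by apply: fin_bigcap_measurable => // i _.
by apply/seteqP; split => x /= Fx i //; exact: Fx.
Qed.

Definition hcube Q : set (Rn R n) :=
  [set x | forall i, Q.1 ord0 i - Q.2 / 2 <= (x : V) ord0 i < Q.1 ord0 i + Q.2 / 2].

Definition ccube Q : set (Rn R n) :=
  [set x | forall i, Q.1 ord0 i - Q.2 / 2 <= (x : V) ord0 i <= Q.1 ord0 i + Q.2 / 2].

Definition obox (ab : V * V) : set (Rn R n) :=
  [set x | forall i, ab.1 ord0 i < (x : V) ord0 i < ab.2 ord0 i].

Lemma measurable_hcube Q : measurable (hcube Q).
Proof.
apply: (measurable_coordinatewise (F := fun i => [set x | _ <= (x : V) ord0 i < _])) => i.
rewrite (_ : mkset _ = [set x : V | Q.1 ord0 i - Q.2 / 2 <= x ord0 i]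
    `&` [set x : V | x ord0 i < Q.1 ord0 i + Q.2 / 2]).
  by apply: measurableI; [exact: measurable_halfspace_ge|exact: measurable_halfspace].
by apply/seteqP; split => x /andP.
Qed.

Lemma measurable_ccube Q : measurable (ccube Q).
Proof.
apply: (measurable_coordinatewise (F := fun i => [set x | _ <= (x : V) ord0 i <= _])) => i.
rewrite (_ : mkset _ = [set x : V | Q.1 ord0 i - Q.2 / 2 <= x ord0 i]
    `&` [set x : V | x ord0 i <= Q.1 ord0 i + Q.2 / 2]).
  by apply: measurableI; [exact: measurable_halfspace_ge|exact: measurable_halfspace_le].
by apply/seteqP; split => x /andP.
Qed.

Lemma measurable_obox ab : measurable (obox ab).
Proof.
apply: (measurable_coordinatewise (F := fun i => [set x | _ < (x : V) ord0 i < _])) => i.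
rewrite (_ : mkset _ = [set x : V | ab.1 ord0 i < x ord0 i]
    `&` [set x : V | x ord0 i < ab.2 ord0 i]).
  by apply: measurableI; [exact: measurable_halfspace_gt|exact: measurable_halfspace].
by apply/seteqP; split => x /andP.
Qed.

Lemma cubeE Q : cube Q = [set x : Rn R n | forall i,
  Q.1 ord0 i - Q.2 / 2 < (x : V) ord0 i < Q.1 ord0 i + Q.2 / 2].
Proof.
by apply/seteqP; split => x xQ i; have := xQ i; rewrite ltr_distl.
Qed.

Lemma measurable_cube Q : measurable (cube Q).
Proof.
rewrite cubeE.
rewrite (_ : mkset _ = obox (\row_i (Q.1 ord0 i - Q.2 / 2),
                             \row_i (Q.1 ord0 i + Q.2 / 2))).
  exact: measurable_obox.
by apply/seteqP; split => x xQ i; have := xQ i; rewrite /= !mxE.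
Qed.

Lemma sub_cube_hcube Q : cube Q `<=` hcube Q.
Proof. by rewrite cubeE => x xQ i; have /andP[/ltW -> ->] := xQ i. Qed.

Lemma sub_hcube_ccube Q : hcube Q `<=` ccube Q.
Proof. by move=> x xQ i; have /andP[-> /ltW ->] := xQ i. Qed.

(** Translations and dilations act on covers by boxes, so that the measure of
    any cube is determined by that of the unit cube. *)
Lemma leb_outer_dilate_le A v (t : R) : 0 < t ->
  (leb_outer [set x | A (t^-1 *: (x - v))] <= (t ^+ n.+1)%:E * leb_outer A)%E.
Proof.
move=> t0.
have tn0 : 0 < t ^+ n.+1 by rewrite exprn_gt0.
rewrite muleC -lee_pdivrMr//.
apply: le_ereal_inf_tmp => _ [B AB <-].
rewrite lee_pdivrMr// muleC -nneseriesZl; last first.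
  by move=> k _; rewrite lee_fin box_vol_ge0.
pose B' k : V * V := (t *: (B k).1 + v, t *: (B k).2 + v).
rewrite (eq_eseriesr (g := fun k => (box_vol (B' k))%:E)); last first.
  move=> k _; rewrite -EFinM; congr EFin.
  rewrite /box_vol (_ : t ^+ n.+1 = \prod_(i < n.+1) t) -?big_split /=; last first.
    by rewrite prodr_const card_ord.
  apply: eq_bigr => i _; rewrite !mxE maxr_pMr ?mulr0 ?ltW//; congr Num.max; ring.
apply: leb_outer_cover => x /= /AB[k _ Bx]; exists k => // i.
have := Bx i; rewrite !mxE /= [t^-1 * _]mulrC ler_pdivlMr// ltr_pdivrMr//.
by rewrite lerBrDr ltrBlDr ![_ * t]mulrC.
Qed.

Lemma leb_outer_dilate A v (t : R) : 0 < t ->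
  (leb_outer [set x | A (t^-1 *: (x - v))] = (t ^+ n.+1)%:E * leb_outer A)%E.
Proof.
move=> t0; apply/eqP; rewrite eq_le leb_outer_dilate_le//=.
have ti0 : 0 < t^-1 by rewrite invr_gt0.
have tn0 : 0 < t ^+ n.+1 by rewrite exprn_gt0.
have := @leb_outer_dilate_le [set x | A (t^-1 *: (x - v))] (- (t^-1 *: v)) _ ti0.
have -> : [set x | [set x | A (t^-1 *: (x - v))] (t^-1^-1 *: (x - - (t^-1 *: v)))] = A.
  apply/seteqP; split => x /=;
    by rewrite invrK opprK [t *: (_ + _)]scalerDr [t *: (t^-1 *: v)]scalerA
      mulfV ?gt_eqF// scale1r addrK scalerA mulVf ?gt_eqF// scale1r.
by rewrite exprVn muleC lee_pdivlMr// muleC.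
Qed.

Definition unit_cube : cube_data := (0, 1).

(** The proof treats this number as an unknown constant: it only uses that a
    cube of side [h] in dimension [n.+1] has measure [unit_vol * h ^+ n.+1]. *)
Definition unit_vol : R := fine (mu (cube unit_cube)).

Lemma leb_hcube_unit Q : is_cube Q ->
  mu (hcube Q) = ((Q.2 ^+ n.+1)%:E * mu (hcube unit_cube))%E.
Proof.
move=> Q0; rewrite -(leb_outer_dilate _ Q.1)//; congr (leb_outer _).
apply/seteqP; split => x xQ i; have := xQ i; rewrite /unit_cube /= !mxE !add0r;
  rewrite [Q.2^-1 * _]mulrC ler_pdivlMr// ltr_pdivrMr//; lra.
Qed.

Lemma leb_cube_unit Q : is_cube Q ->
  mu (cube Q) = ((Q.2 ^+ n.+1)%:E * mu (cube unit_cube))%E.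
Proof.
move=> Q0; rewrite -(leb_outer_dilate _ Q.1)//; congr (leb_outer _).
rewrite !cubeE; apply/seteqP; split => x xQ i; have := xQ i; rewrite /unit_cube /= !mxE !add0r;
  rewrite [Q.2^-1 * _]mulrC ltr_pdivlMr// ltr_pdivrMr//; lra.
Qed.

Lemma leb_hcube_unit_le1 : (mu (hcube unit_cube) <= 1)%E.
Proof.
pose ab : V * V := (const_mx (- (1 / 2)), const_mx (1 / 2)).
have sub : hcube unit_cube `<=` box ab.
  by move=> x xQ i; have := xQ i; rewrite /unit_cube /= !mxE !add0r.
apply: (le_trans (le_outer_measure (@leb_outer R n) _ _ sub)).
apply: (le_trans (leb_outer_box _)); rewrite lee_fin /box_vol.
rewrite big1// => i _; rewrite !mxE opprK /=.
by rewrite (_ : 1 / 2 + 1 / 2 = 1 :> R) ?max_r//; field.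
Qed.


(** The faces of a cube are null, by homogeneity: a closed-open cube of side
    [1 - e] fits inside the open unit cube. *)
Lemma leb_hcube_cube_unit : mu (hcube unit_cube) = mu (cube unit_cube).
Proof.
apply/eqP; rewrite eq_le [X in _ && X]le_measure ?inE ?andbT;
  [|exact: measurable_cube|exact: measurable_hcube|exact: sub_cube_hcube].
have a1 := leb_hcube_unit_le1.
have ba : (mu (cube unit_cube) <= mu (hcube unit_cube))%E.
  by apply: le_measure; rewrite ?inE;
    [exact: measurable_cube|exact: measurable_hcube|exact: sub_cube_hcube].
have afin : mu (hcube unit_cube) \is a fin_num.
  by rewrite ge0_fin_numE// (le_lt_trans a1)// ltry.
have bfin : mu (cube unit_cube) \is a fin_num.
  by rewrite ge0_fin_numE// (le_lt_trans ba)// (le_lt_trans a1)// ltry.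
have bernoulli (e : R) k : 0 <= e -> e <= 1 -> 1 - k%:R * e <= (1 - e) ^+ k.
  move=> e0 e1; elim: k => [|k ih]; first by rewrite mul0r subr0 expr0.
  rewrite exprS -natr1; have k0 : 0 <= k%:R :> R by [].
  apply: (@le_trans _ _ ((1 - e) * (1 - k%:R * e))).
    have := mulr_ge0 (mulr_ge0 k0 e0) e0; lra.
  by rewrite ler_wpM2l// subr_ge0.
have shrink (e : R) : 0 < e -> e < 1 ->
    (1 - e) ^+ n.+1 * fine (mu (hcube unit_cube)) <= fine (mu (cube unit_cube)).
  move=> e0 e1; rewrite -lee_fin EFinM !fineK//.
  have Q0 : is_cube (0 : V, 1 - e) by rewrite /is_cube /= subr_gt0.
  rewrite -(leb_hcube_unit Q0); apply: le_measure; rewrite ?inE;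
    [exact: measurable_hcube|exact: measurable_cube|].
  move=> x xQ; rewrite cubeE => i; have := xQ i; rewrite /= !mxE !add0r; lra.
rewrite -(fineK afin) -(fineK bfin) lee_fin; apply/ler_addgt0Pr => d d0.
have a01 : 0 <= fine (mu (hcube unit_cube)) <= 1.
  by rewrite fine_ge0//= -lee_fin fineK.
have N0 : 0 < n.+1%:R :> R by [].
pose e := Num.min (2^-1) (d / n.+1%:R).
have e0 : 0 < e by rewrite lt_min invr_gt0 ltr0n/= divr_gt0.
have e1 : e < 1 by rewrite gt_min invf_lt1// ltr1n.
have ed : n.+1%:R * e <= d.
  by rewrite mulrC -ler_pdivlMr// ge_min lexx orbT.
have := shrink e e0 e1; have := bernoulli e n.+1 (ltW e0) (ltW e1).
move: a01 => /andP[]; set a := fine _; set b := fine _; set t := _ ^+ _.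
move=> a0 a1' h1 h2.
have : (1 - d) * a <= t * a by rewrite ler_wpM2r//; lra.
have : d * a <= d by rewrite ler_piMr// ltW.
lra.
Qed.

Lemma unit_vol_ge0 : 0 <= unit_vol.
Proof. exact: fine_ge0. Qed.

Lemma leb_cube Q : is_cube Q -> mu (cube Q) = (unit_vol * Q.2 ^+ n.+1)%:E.
Proof.
move=> Q0; rewrite leb_cube_unit// muleC EFinM fineK// -leb_hcube_cube_unit.
by rewrite ge0_fin_numE// (le_lt_trans leb_hcube_unit_le1)// ltry.
Qed.

Lemma leb_hcube Q : is_cube Q -> mu (hcube Q) = (unit_vol * Q.2 ^+ n.+1)%:E.
Proof. by move=> Q0; rewrite -leb_cube// leb_hcube_unit// leb_cube_unit// leb_hcube_cube_unit. Qed.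

Lemma leb_hcubeE Q : is_cube Q -> mu (hcube Q) = mu (cube Q).
Proof. by move=> Q0; rewrite leb_cube// leb_hcube. Qed.

Lemma leb_hcubeD Q : is_cube Q -> mu (hcube Q `\` cube Q) = 0%E.
Proof.
move=> Q0; have mc := measurable_cube Q; have mh := measurable_hcube Q.
have fin : (mu (hcube Q) < +oo)%E by rewrite leb_hcube// ltry.
have -> : mu (hcube Q `\` cube Q) = (mu (hcube Q) - mu (hcube Q `&` cube Q))%E.
  exact: measureD.
by rewrite (setIidr (@sub_cube_hcube Q)) leb_hcubeE// leb_cube// subee.
Qed.

Lemma le_abs_coord_mx (x : V) i : `|x ord0 i| <= `|x|.
Proof.
rewrite [leRHS]/Num.norm /= mx_normrE.
by apply/bigmax_geP; right => /=; exists (ord0, i).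
Qed.

Lemma leb_setT_eq0 : unit_vol = 0 -> mu setT = 0%E.
Proof.
move=> v0; apply/eqP; rewrite eq_le measure_ge0 andbT.
pose F k : set (Rn R n) := cube (0 : V, k.+1%:R).
have F0 k : mu (F k) = 0%E by rewrite leb_cube ?v0 ?mul0r// /is_cube /=.
apply: (@le_trans _ _ (\sum_(0 <= k <oo) mu (F k))%E); last first.
  by rewrite eseries0// => k _ _; exact: F0.
apply: measure_sigma_subadditive => //; first by move=> k; exact: measurable_cube.
move=> x _; exists (Num.truncn (2 * `|(x : V)|)) => // i.
rewrite /= mxE subr0 ltr_pdivlMr// mulrC (le_lt_trans _ (truncnS_gt _))//.
by rewrite ler_pM2l//; exact: le_abs_coord_mx.
Qed.

(** Doubling every box of a cover puts each point of [A] in the interior of a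
    box, and costs only a dimensional constant. *)
Lemma open_hull A (e : R) : (leb_outer A < e%:E)%E ->
  exists O : set (Rn R n), [/\ measurable O, A `<=` O,
    (mu O <= (2 ^+ n.+1 * e)%:E)%E &
    forall x, O x -> exists2 d : R, 0 < d &
      forall y, (forall i, `|(y : V) ord0 i - (x : V) ord0 i| < d) -> O y].
Proof.
move=> Ae; have [_ [B AB <-] Be] := ereal_inf_lt Ae.
(* Only lower corners move, since the boxes are already open at their upper
   faces. *)
pose D k : V * V := ((B k).1 *+ 2 - (B k).2, (B k).2).
have mD k := measurable_obox (D k).
exists (\bigcup_k obox (D k)); split.
- exact: bigcup_measurable.
- move=> x /AB[k _ Bx]; exists k => // i; have := Bx i; rewrite /D /= !mxE; lra.
- apply: (@le_trans _ _ (\sum_(0 <= k <oo) (2 ^+ n.+1)%:E * (box_vol (B k))%:E)%E).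
    apply: (le_trans (measure_sigma_subadditive mu mD _ _)) => //.
      exact: bigcup_measurable.
    apply: lee_nneseries => k _ *; first exact: measure_ge0.
    rewrite -EFinM.
    have -> : 2 ^+ n.+1 * box_vol (B k) = box_vol (D k).
      rewrite /box_vol (_ : 2 ^+ n.+1 = \prod_(i < n.+1) 2) -?big_split /=.
        apply: eq_bigr => i _; rewrite !mxE maxr_pMr ?mulr0//.
        by congr Num.max; ring.
      by rewrite prodr_const card_ord.
    have sub : obox (D k) `<=` box (D k) by move=> x xD i; have /andP[/ltW -> ->] := xD i.
    exact: (le_trans (le_outer_measure (@leb_outer R n) _ _ sub) (leb_outer_box _)).
  rewrite nneseriesZl; last by move=> k _; rewrite lee_fin box_vol_ge0.
  by rewrite EFinM lee_pmul2l ?ltW// lte_fin exprn_gt0.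
- move=> x [k _ Dx].
  pose d := \big[Num.min/1]_(i < n.+1)
    Num.min ((x : V) ord0 i - (D k).1 ord0 i) ((D k).2 ord0 i - (x : V) ord0 i).
  exists d.
    rewrite /d; apply/bigmin_gtP; split => // i _.
    by rewrite lt_min !subr_gt0; exact: Dx.
  move=> y yx; exists k => // i.
  have dle : d <= Num.min ((x : V) ord0 i - (D k).1 ord0 i)
      ((D k).2 ord0 i - (x : V) ord0 i) by exact: bigmin_le_cond.
  have := lt_le_trans (yx i) dle; rewrite lt_min !ltr_norml; lra.
Qed.

End lebesgue_measure_geometry.

(** * Dyadic subcubes *)

Section dyadic_cubes.
Context {R : realType} {n : nat}.
Local Notation V := 'rV[R]_n.+1.
Local Notation mu := (leb R n).
Local Notation cube_data := ('rV[R]_n.+1 * R)%type.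
Implicit Types (x y : Rn R n) (Q P : cube_data).

Lemma floor_double (u v : R) : Num.floor (2 * u) = Num.floor (2 * v) ->
  Num.floor u = Num.floor v.
Proof.
move=> uv; apply: floor_def.
have /andP[u1 u2] := floor_itv (2 * u); rewrite uv in u1 u2.
have /andP[v1 v2] := floor_itv (2 * v).
have /andP[w1 w2] := floor_itv v.
rewrite intrD in u2 v2 w2; rewrite intrD.
have : ((Num.floor v + Num.floor v)%:~R : R) <= (Num.floor (2 * v))%:~R.
  by rewrite ler_int floor_ge_int_tmp intrD; lra.
have : ((Num.floor (2 * v) + 1)%:~R : R) <= (Num.floor v + Num.floor v + 2)%:~R.
  by rewrite ler_int lezD1 floor_lt_int !intrD; lra.
rewrite !intrD; lra.
Qed.

(** Affine coordinates in which [hcube Q] is the half-open unit cube with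
    corner 0, so that dyadic cubes are read off from integer parts. *)
Definition relcoord Q x (i : 'I_n.+1) : R :=
  ((x : V) ord0 i - Q.1 ord0 i) / Q.2 + 2^-1.

Definition grid_cube Q (k : nat) (m : 'I_n.+1 -> int) : cube_data :=
  (\row_i (Q.1 ord0 i + Q.2 * (((m i)%:~R + 2^-1) / 2 ^+ k - 2^-1)), Q.2 / 2 ^+ k).

(** A dyadic cube is indexed by one of its points, not by an address: any other
    point of it is as good an index ([dyadic_eq]), and nestedness becomes a
    statement about a single point ([dyadic_nested]). *)
Definition dyadic Q k x : cube_data :=
  grid_cube Q k (fun i => Num.floor (2 ^+ k * relcoord Q x i)).

Lemma hcube_relcoord Q x : is_cube Q ->
  hcube Q x <-> forall i, 0 <= relcoord Q x i < 1.
Proof.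
move=> Q0; rewrite /hcube /relcoord /=; split => xQ i; have := xQ i.
- move=> /andP[h1 h2].
  rewrite -lerBlDr -ltrBrDr ler_pdivlMr// ltr_pdivrMr//; lra.
- rewrite -lerBlDr -ltrBrDr ler_pdivlMr// ltr_pdivrMr//; lra.
Qed.

Lemma hcube_grid Q k m y : is_cube Q ->
  hcube (grid_cube Q k m) y <-> forall i, Num.floor (2 ^+ k * relcoord Q y i) = m i.
Proof.
move=> Q0; have k0 : 0 < 2 ^+ k :> R by rewrite exprn_gt0.
have Pk : is_cube (grid_cube Q k m) by rewrite /is_cube /= divr_gt0.
have E i : relcoord (grid_cube Q k m) y i = 2 ^+ k * relcoord Q y i - (m i)%:~R.
  rewrite /relcoord /= mxE; field.
  by rewrite !gt_eqF.
rewrite hcube_relcoord//; split => h i; have := h i; rewrite E.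
- by move=> h'; apply: floor_def; rewrite intrD; lra.
- move=> <-; have := floor_itv (2 ^+ k * relcoord Q y i); rewrite intrD; lra.
Qed.

Lemma hcube_dyadic Q k x y : is_cube Q ->
  hcube (dyadic Q k x) y <-> forall i,
  Num.floor (2 ^+ k * relcoord Q y i) = Num.floor (2 ^+ k * relcoord Q x i).
Proof. exact: hcube_grid. Qed.

Lemma mem_dyadic Q k x : is_cube Q -> hcube (dyadic Q k x) x.
Proof. by move=> Q0; apply/hcube_dyadic. Qed.

Lemma dyadic_eq Q k x y : is_cube Q -> hcube (dyadic Q k x) y ->
  dyadic Q k y = dyadic Q k x.
Proof.
move=> Q0 /hcube_dyadic => /(_ Q0) h; rewrite /dyadic; congr grid_cube.
exact/funext.
Qed.

Lemma dyadic_nested Q k j x : is_cube Q -> (j <= k)%N ->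
  hcube (dyadic Q k x) `<=` hcube (dyadic Q j x).
Proof.
move=> Q0 /subnK <-; elim: (k - j)%N => [//|d ih] y.
rewrite addSn => h; apply: ih; move: h => /hcube_dyadic h.
apply/hcube_dyadic => // i; apply: floor_double.
by rewrite !mulrA -exprS; exact: h.
Qed.

Lemma is_cube_dyadic Q k x : is_cube Q -> is_cube (dyadic Q k x).
Proof. by move=> Q0; rewrite /is_cube /= divr_gt0// exprn_gt0. Qed.

Lemma dyadic0 Q x : is_cube Q -> hcube Q x -> dyadic Q 0 x = Q.
Proof.
move=> Q0 /hcube_relcoord => /(_ Q0) h; rewrite /dyadic /grid_cube.
rewrite [RHS]surjective_pairing expr0 divr1; congr pair.
apply/rowP => i; rewrite !mxE mul1r divr1.
have -> : Num.floor (relcoord Q x i) = 0 by apply: floor_def; exact: h.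
by rewrite add0r subrr mulr0 addr0.
Qed.

(** The inclusion of [P] in [Q], stated on centers and sides: in this form it
    passes to the open cubes and, for [P] smaller than [Q], to the triples. *)
Definition inner P Q := forall i, `|P.1 ord0 i - Q.1 ord0 i| <= (Q.2 - P.2) / 2.

Lemma inner_hcube P Q : inner P Q -> hcube P `<=` hcube Q.
Proof.
move=> PQ x xP i; have := xP i; have := PQ i; rewrite ler_norml; lra.
Qed.

Lemma inner_cube_triple P Q : P.2 <= Q.2 -> inner P Q ->
  cube (triple P) `<=` cube (triple Q).
Proof.
move=> le PQ x; rewrite !cubeE => xP i; have := xP i; have := PQ i.
rewrite ler_norml /=; lra.
Qed.

Lemma dyadic_inner Q k x : is_cube Q -> hcube Q x -> inner (dyadic Q k x) Q.
Proof.
move=> Q0 /hcube_relcoord => /(_ Q0) h i; rewrite /= mxE.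
have k0 : 0 < 2 ^+ k :> R by rewrite exprn_gt0.
set m := Num.floor _.
have m0 : 0 <= m%:~R :> R.
  by rewrite ler0z floor_ge_int_tmp mulr_ge0 ?(ltW k0)//; have /andP[] := h i.
have m1 : m%:~R + 1 <= 2 ^+ k :> R.
  have -> : 2 ^+ k = (2 ^+ k)%:~R :> R by rewrite rmorphXn.
  rewrite -[1]/(1%:~R) -intrD ler_int lezD1 floor_lt_int rmorphXn /=.
  by rewrite gtr_pMr//; have /andP[] := h i.
rewrite ler_norml.
have -> : Q.1 ord0 i + Q.2 * ((m%:~R + 2^-1) / 2 ^+ k - 2^-1) - Q.1 ord0 i =
  Q.2 / 2 ^+ k * (m%:~R + 2^-1 - 2 ^+ k / 2) by field; rewrite gt_eqF.
have -> : (Q.2 - Q.2 / 2 ^+ k) / 2 = Q.2 / 2 ^+ k * (2 ^+ k / 2 - 2^-1).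
  by field; rewrite gt_eqF.
rewrite -mulrN !ler_pM2l ?divr_gt0//; lra.
Qed.

Lemma leb_dyadicS Q k x : is_cube Q ->
  mu (hcube (dyadic Q k x)) = ((2 ^+ n.+1)%:E * mu (hcube (dyadic Q k.+1 x)))%E.
Proof.
move=> Q0; have h j := is_cube_dyadic j x Q0; rewrite !leb_hcube//.
rewrite -EFinM /=; congr EFin.
rewrite [2 ^+ k.+1]exprS; have k0 : 0 < 2 ^+ k :> R by rewrite exprn_gt0.
have -> : Q.2 / 2 ^+ k = 2 * (Q.2 / (2 * 2 ^+ k)) by field; rewrite gt_eqF.
by rewrite exprMn mulrCA.
Qed.

Lemma countable_dyadic Q : countable [set dyadic Q kx.1 kx.2 | kx in [set: nat * Rn R n]].
Proof.
pose F (km : nat * {ffun 'I_n.+1 -> int}) := grid_cube Q km.1 km.2.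
apply: (@sub_countable _ _ _ (F @` setT)); last first.
  by apply: sub_countable (card_image_le _ _) _; exact: countableP.
apply: subset_card_le => _ [[k x] _ <-] /=.
exists (k, [ffun i => Num.floor (2 ^+ k * relcoord Q x i)]) => //.
by rewrite /F /dyadic /=; congr grid_cube; apply/funext => i; rewrite ffunE.
Qed.

End dyadic_cubes.

(** * Sums over countable families of sets *)

Section countable_sums.
Context d (T : measurableType d) (R : realType) (I : choiceType).
Implicit Types (S : set I) (F : I -> set T).

(** Countable additivity speaks of sequences; an injection of the index set into
    [nat], with empty sets at the unused indices, carries it over to a countable
    family of cubes. *)
Lemma sequence_of_countable S F : countable S -> trivIset S F ->
  (forall i, S i -> measurable (F i)) ->
  exists G : nat -> set T, [/\ forall k, measurable (G k), trivIset setT G,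
    \bigcup_k G k = \bigcup_(i in S) F i &
    forall a : set T -> \bar R, a set0 = 0%E -> (forall A, 0 <= a A)%E ->
      (\sum_(0 <= k <oo) a (G k) = \esum_(i in S) a (F i))%E].
Proof.
move=> /countable_injP[f finj] tF mF.
pose G k := \bigcup_(i in S `&` [set i | f i = k]) F i.
have GF i : S i -> G (f i) = F i.
  move=> Si; apply/seteqP; split => x; last by exists i.
  by move=> [j [Sj /= fji]]; rewrite (finj _ _ _ _ fji)// inE.
have G0 k : ~ (f @` S) k -> G k = set0.
  by move=> nk; apply/seteqP; split => // x [i [Si fik] _]; apply: nk; exists i.
have Gk k : G k = set0 \/ exists2 i, S i & k = f i.
  have [[i Si <-]|/G0] := pselect ((f @` S) k); last by left.
  by right; exists i.
exists G; split.
- move=> k; have [->//|[i Si ->]] := Gk k; rewrite GF//; exact: mF.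
- apply/trivIsetP => j k _ _ jk.
  have [->|[i Si ji]] := Gk j; first exact: set0I.
  have [->|[i' Si' ki]] := Gk k; first exact: setI0.
  rewrite ji ki !GF//; move/trivIsetP : tF; apply => //.
  by apply: contra_neq jk => ii; rewrite ji ki ii.
- apply/seteqP; split => x; first by move=> [k _ [i [Si _] Fx]]; exists i.
  by move=> [i Si Fx]; exists (f i) => //; exists i.
- move=> a a0 age0; rewrite nneseries_esumT//.
  transitivity (\esum_(k in f @` S) a (G k)).
    rewrite [RHS]esum_mkcond; apply: eq_esum => k _.
    by case: ifPn => //; rewrite notin_setE => /G0 ->.
  by rewrite esum_image//; apply: eq_esum => i Si; rewrite GF.
Qed.

Lemma measure_countable_bigcup (mu : {measure set T -> \bar R}) S F :
  countable S -> trivIset S F -> (forall i, S i -> measurable (F i)) ->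
  mu (\bigcup_(i in S) F i) = \esum_(i in S) mu (F i).
Proof.
move=> cS tF mF; have [G [mG tG <- /(_ mu (measure0 mu))]] := sequence_of_countable cS tF mF.
move=> <-; last by move=> A; exact: measure_ge0.
by rewrite measure_bigcup//; apply: eq_eseriesl => k; rewrite in_setT.
Qed.

Lemma integral_countable_bigcup (mu : {measure set T -> \bar R}) S F (h : T -> \bar R) :
  countable S -> trivIset S F -> (forall i, S i -> measurable (F i)) ->
  measurable_fun setT h -> (forall x, 0 <= h x)%E ->
  (\int[mu]_(x in \bigcup_(i in S) F i) h x = \esum_(i in S) \int[mu]_(x in F i) h x)%E.
Proof.
move=> cS tF mF mh h0.
have [G [mG tG <- /(_ (fun A => \int[mu]_(x in A) h x)%E)]] := sequence_of_countable cS tF mF.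
move=> <-; [|exact: integral_set0|by move=> A; exact: integral_ge0].
rewrite ge0_integral_bigcup//; exact: measurable_funTS.
Qed.

Lemma measurable_countable_bigcup S F : countable S ->
  (forall i, S i -> measurable (F i)) -> measurable (\bigcup_(i in S) F i).
Proof.
move=> /countable_injP[f finj] mF.
have -> : \bigcup_(i in S) F i =
    \bigcup_(k in f @` S) \bigcup_(i in S `&` [set i | f i = k]) F i.
  apply/seteqP; split => x; first by move=> [i Si Fx]; exists (f i); exists i.
  by move=> [_ _ [i [Si _] Fx]]; exists i.
apply: bigcup_measurable => _ [i Si <-].
rewrite (_ : _ `&` _ = [set i]) ?bigcup_set1; first exact: mF.
apply/seteqP; split => [j [Sj fji]|_ ->//].
by apply: finj => //; rewrite inE.
Qed.

End countable_sums.

Lemma esum_disjoint_bigcup (R : realType) (I J : choiceType) (S : set I)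
    (F : I -> set J) (a : J -> \bar R) :
  trivIset S F -> (forall i j, S i -> F i j -> 0 <= a j)%E ->
  \esum_(j in \bigcup_(i in S) F i) a j = \esum_(i in S) \esum_(j in F i) a j.
Proof.
move=> tF a0; rewrite esum_esum//; apply: reindex_esum => //; split.
- by move=> [/= i j] [Si Fj]; exists i.
- move=> [/= i1 j1] [/= i2 j2]; rewrite !inE /= => -[S1 F1] [S2 F2] j12.
  by rewrite -j12 in F2 *; congr pair; apply: tF => //; exists j1.
- by move=> j [i Si Fj]; exists (i, j).
Qed.

Lemma ge0_esumZl (R : realType) (I : choiceType) (S : set I) (a : I -> \bar R) (c : R) :
  0 <= c -> (forall i, 0 <= a i)%E ->
  (\esum_(i in S) (c%:E * a i) = c%:E * \esum_(i in S) a i)%E.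
Proof.
move=> c0 a0; have [->|cn0] := eqVneq c 0.
  by rewrite mul0e esum1// => i _; rewrite mul0e.
have {cn0}c0 : 0 < c by rewrite lt_neqAle eq_sym cn0.
have le (b : I -> \bar R) (t : R) : 0 < t -> (forall i, 0 <= b i)%E ->
    (\esum_(i in S) (t%:E * b i) <= t%:E * \esum_(i in S) b i)%E.
  move=> t0 b0; apply: ge_ereal_sup => _ [A AS <-].
  rewrite -ge0_mule_fsumr//.
  by rewrite lee_pmul2l//; apply: ereal_sup_ubound; exists A.
apply/eqP; rewrite eq_le le//=.
have ci0 : 0 < c^-1 by rewrite invr_gt0.
have ca0 i : (0 <= c%:E * a i)%E by rewrite mule_ge0// lee_fin ltW.
have := le _ _ ci0 ca0.
under eq_esum do rewrite muleA -EFinM mulVf ?gt_eqF// mul1e.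
by rewrite -(@lee_pmul2l _ c%:E)// muleA -EFinM mulfV ?gt_eqF// mul1e.
Qed.

(** * Stopping cubes *)

Section stopping_cubes.
Context {R : realType} {n : nat}.
Local Notation V := 'rV[R]_n.+1.
Local Notation mu := (leb R n).
Local Notation cube_data := ('rV[R]_n.+1 * R)%type.
Implicit Types (x y : Rn R n) (Q P : cube_data).
Hypothesis vol_gt0 : 0 < @unit_vol R n.

Lemma leb_hcube_gt0 Q : is_cube Q -> (0 < mu (hcube Q))%E.
Proof. by move=> Q0; rewrite leb_hcube// lte_fin mulr_gt0// exprn_gt0. Qed.

(** In dimension [n.+1] the threshold [2 ^- n.+2] is half of the reciprocal of
    the number of children of a dyadic cube: this is what leaves room in a heavy
    cube with a light parent. *)
Definition heavy (O : set (Rn R n)) P :=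
  (mu (hcube P) < (2 ^+ n.+2)%:E * mu (hcube P `&` O))%E.

Definition stopping_cubes (O : set (Rn R n)) Q : set cube_data :=
  [set P | exists k x, [/\ hcube Q x, P = dyadic Q k x, heavy O P &
     forall j, (j < k)%N -> ~ heavy O (dyadic Q j x)]].

(** Calderon-Zygmund stopping. As [O] is open, each of its points has small
    dyadic cubes inside [O], which are heavy; so the stopping cubes cover every
    point of [O] in [Q]. The smallness of [O] keeps [Q] itself light, so that a
    stopping cube has a light parent; it is then at most half full of [O], and
    has points outside [O]. *)
Lemma stopping_cubesP (O : set (Rn R n)) Q : is_cube Q -> measurable O ->
  (forall x, O x -> exists2 d : R, 0 < d &
     forall y, (forall i, `|(y : V) ord0 i - (x : V) ord0 i| < d) -> O y) ->
  ((2 ^+ n.+3)%:E * mu O <= mu (hcube Q))%E ->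
  [/\ countable (stopping_cubes O Q),
      forall P, stopping_cubes O Q P ->
        [/\ is_cube P, P.2 <= Q.2 / 2, inner P Q, heavy O P &
            exists x, cube P x /\ ~ O x],
      trivIset (stopping_cubes O Q) hcube &
      hcube Q `&` O `<=` \bigcup_(P in stopping_cubes O Q) hcube P].
Proof.
move=> Q0 mO openO small.
have mP P := measurable_hcube P.
have light0 : ~ heavy O Q.
  rewrite /heavy => h; have : (mu (hcube Q) < mu (hcube Q))%E; last by rewrite ltxx.
  apply: (lt_le_trans h); apply: le_trans small.
  apply: lee_pmul => //.
    by rewrite lee_fin ler_eXn2l ?ltr1n.
  by apply: le_measure; rewrite ?inE; [exact: measurableI|by []|exact: subIsetr].
have disjoint k x k' x' y : heavy O (dyadic Q k x) ->
    (forall j, (j < k')%N -> ~ heavy O (dyadic Q j x')) ->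
    hcube (dyadic Q k x) y -> hcube (dyadic Q k' x') y -> (k' <= k)%N.
  move=> hk light yk yk'; rewrite leqNgt; apply/negP => kk'.
  apply: (light _ kk').
  have := @dyadic_nested _ _ Q k' k x' Q0 (ltnW kk') y yk' => /(dyadic_eq Q0) <-.
  by rewrite (dyadic_eq Q0 yk).
split.
- apply: sub_countable (countable_dyadic Q); apply: subset_card_le.
  by move=> P [k [x [_ -> _ _]]]; exists (k, x).
- move=> P [[|k] [x [Qx -> hP light]]].
    by exfalso; apply: light0; rewrite -(dyadic0 Q0 Qx).
  have cP := is_cube_dyadic k.+1 x Q0.
  split => //.
  + rewrite /= exprS invfM mulrA ler_piMr//; first by rewrite divr_ge0// ltW.
    by rewrite invf_le1 ?exprn_gt0// exprn_ege1// ler1n.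
  + exact: dyadic_inner.
  + apply/not_existsP => sub.
    have {}sub : cube (dyadic Q k.+1 x) `<=` O.
      by move=> y Py; apply: contrapT => nOy; apply: (sub y).
    apply: (light k (leqnn _)); rewrite /heavy leb_dyadicS//.
    rewrite [2 ^+ n.+2]exprSr EFinM -muleA lte_pmul2l ?lte_fin ?exprn_gt0//.
    apply: (@lt_le_trans _ _ (2%:E * mu (hcube (dyadic Q k.+1 x)))%E).
      rewrite -[ltLHS]mul1e lte_pmul2r ?lte_fin ?ltr1n ?leb_hcube_gt0//.
      by rewrite leb_hcube.
    apply: lee_pmul => //; rewrite leb_hcubeE//.
    apply: le_measure; rewrite ?inE; first exact: measurable_cube.
      exact: measurableI.
    move=> y Py; split; last exact: sub.
    by apply: (@dyadic_nested _ _ Q k.+1 k x) => //; exact: sub_cube_hcube.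
- move=> _ _ [k [x [Qx -> hk lk]]] [k' [x' [Qx' -> hk' lk']]] [y [yk yk']].
  have kk' : k = k'.
    by apply/eqP; rewrite eqn_leq; apply/andP; split;
      [exact: disjoint yk' yk|exact: disjoint yk yk'].
  by rewrite -kk' in yk' *; rewrite -(dyadic_eq Q0 yk) (dyadic_eq Q0 yk').
- move=> x [Qx Ox].
  have [d d0 dO] := openO x Ox.
  have ex : exists k, `[< heavy O (dyadic Q k x) >].
    exists (Num.truncn (Q.2 / d)).+1; set k := _.+1; apply/asboolP.
    have kd : Q.2 / 2 ^+ k < d.
      have k0 : 0 < 2 ^+ k :> R by rewrite exprn_gt0.
      rewrite ltr_pdivrMr// mulrC -ltr_pdivrMr//.
      apply: lt_trans (truncnS_gt _) _.
      by rewrite -natrX ltr_nat ltn_expl.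
    rewrite /heavy (setIidl _); last first.
      move=> y yP; apply: dO => i; have := yP i; have := mem_dyadic k x Q0 i.
      rewrite [(dyadic Q k x).2]/=; set c := _ ord0 i; set h := (X in X < d) in kd *.
      by rewrite -/h ltr_norml; lra.
    have cP := is_cube_dyadic k x Q0.
    rewrite -[ltLHS]mul1e lte_pmul2r ?leb_hcube_gt0//; last by rewrite leb_hcube.
    by rewrite lte_fin exprn_egt1// ltr1n.
  exists (dyadic Q (ex_minn ex) x); last exact: mem_dyadic.
  case: ex_minnP => k /asboolP hk mink; exists k, x; split => // j jk hj.
  by have := mink j (asboolT hj); rewrite leqNgt jk.
Qed.

End stopping_cubes.

(** * Iterating a local estimate *)

Section sparse_iteration.
Context {R : realType} {n : nat}.
Local Notation V := 'rV[R]_n.+1.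
Local Notation mu := (leb R n).
Local Notation cube_data := ('rV[R]_n.+1 * R)%type.
Implicit Types (x y : Rn R n) (Q P : cube_data).

Lemma inner_refl Q : inner Q Q.
Proof. by move=> i; rewrite !subrr normr0 mul0r. Qed.

Lemma inner_trans P Q Q' : inner P Q -> inner Q Q' -> inner P Q'.
Proof.
move=> PQ QQ' i; have := PQ i; have := QQ' i; rewrite !ler_norml; lra.
Qed.

Lemma hcube_nonempty Q : is_cube Q -> hcube Q !=set0.
Proof. by move=> Q0; exists (Q.1 : Rn R n) => i; have : 0 < Q.2 := Q0; lra. Qed.

(** [C] is a possible set of children of [Q]. They leave over at least half of
    [Q], which is the part that a sparse family assigns to [Q]. On this half the
    mass of [h Q] is bounded, and on any part [Y P] of a child [P] it can be
    traded for the mass of [h P], at a total price of [a Q]. *)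
Definition local_step (h : cube_data -> Rn R n -> \bar R) (a : cube_data -> \bar R)
    Q (C : set cube_data) :=
  [/\ countable C,
      forall P, C P -> [/\ is_cube P, P.2 <= Q.2 / 2 & inner P Q],
      trivIset C hcube,
      (2%:E * mu (\bigcup_(P in C) hcube P) <= mu (hcube Q))%E &
      forall Y : cube_data -> set (Rn R n),
        (forall P, C P -> measurable (Y P) /\ Y P `<=` hcube P) ->
        (\int[mu]_(x in (hcube Q `\` \bigcup_(P in C) hcube P) `|`
            \bigcup_(P in C) Y P) h Q x
          <= a Q + \esum_(P in C) \int[mu]_(x in Y P) h P x)%E].

Section iteration.
Variables (h : cube_data -> Rn R n -> \bar R) (a : cube_data -> \bar R).
Variable C : cube_data -> set cube_data.
Hypothesis h_ge0 : forall Q x, (0 <= h Q x)%E.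
Hypothesis mh : forall Q, is_cube Q -> measurable_fun setT (h Q).
Hypothesis a_ge0 : forall Q, is_cube Q -> (0 <= a Q)%E.
Hypothesis stepC : forall Q, is_cube Q -> local_step h a Q (C Q).

Definition leftover Q := hcube Q `\` \bigcup_(P in C Q) hcube P.

(** The recursion runs from the root down: the first [N] generations below [Q]
    are [Q] and the first [N - 1] generations below each child. Estimates for
    [Q] then follow by induction on [N] from those for its children. *)
Fixpoint descendants N Q : set cube_data :=
  if N is N'.+1 then [set Q] `|` \bigcup_(P in C Q) descendants N' P else set0.

(** The union of the leftovers of these generations. *)
Fixpoint exhausted N Q : set (Rn R n) :=
  if N is N'.+1 then leftover Q `|` \bigcup_(P in C Q) exhausted N' P else set0.

Lemma measurable_children Q : is_cube Q -> measurable (\bigcup_(P in C Q) hcube P).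
Proof.
move=> Q0; have [cC _ _ _ _] := stepC Q0.
by apply: measurable_countable_bigcup => // P _; exact: measurable_hcube.
Qed.

Lemma measurable_leftover Q : is_cube Q -> measurable (leftover Q).
Proof.
by move=> Q0; apply: measurableD; [exact: measurable_hcube|exact: measurable_children].
Qed.

Lemma leb_leftover Q : is_cube Q -> (mu (hcube Q) <= 2%:E * mu (leftover Q))%E.
Proof.
move=> Q0; have [cC CP _ half _] := stepC Q0.
set U := \bigcup_(P in C Q) hcube P in half *.
have mU := measurable_children Q0.
have UQ : U `<=` hcube Q by move=> x [P /CP[_ _ PQ] Px]; exact: inner_hcube PQ _ Px.
have Qfin : mu (hcube Q) \is a fin_num by rewrite leb_hcube.
have Ufin : mu U \is a fin_num.
  rewrite ge0_fin_numE// (@le_lt_trans _ _ (mu (hcube Q)))// ?ltey_eq ?Qfin//.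
  by apply: le_measure; rewrite ?inE//; exact: measurable_hcube.
have -> : mu (leftover Q) = (mu (hcube Q) - mu U)%E.
  have -> : mu U = mu (hcube Q `&` U) by rewrite setIidr.
  apply: measureD => //; first exact: measurable_hcube.
  by rewrite ltey_eq; apply/orP; left.
move: half; rewrite -(fineK Qfin) -(fineK Ufin) -EFinB -!EFinM !lee_fin; lra.
Qed.

Lemma descendantsP N Q P : is_cube Q -> descendants N Q P ->
  [/\ is_cube P, P.2 <= Q.2 & inner P Q].
Proof.
elim: N Q => [|N ih] Q Q0 //= [->|[P' CP' PP']].
  by split => //; exact: inner_refl.
have [_ /(_ _ CP')[cP' le PQ] _ _ _] := stepC Q0.
have [cP le' PP] := ih _ cP' PP'; split => //; last exact: inner_trans PQ.
apply: le_trans le' (le_trans le _).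
by rewrite ler_pdivrMr// mulr2n mulrDr mulr1 lerDl ltW.
Qed.

Lemma descendants_strict N Q P P' : is_cube Q -> C Q P' -> descendants N P' P ->
  P <> Q.
Proof.
move=> Q0 CP' PP' PQ; have [_ /(_ _ CP')[cP' le _] _ _ _] := stepC Q0.
have [_ le' _] := descendantsP cP' PP'; rewrite PQ in le'.
have : 0 < Q.2 := Q0; lra.
Qed.

Lemma descendantsS N Q : descendants N Q `<=` descendants N.+1 Q.
Proof.
elim: N Q => [|N ih] Q //= P [->|[P' CP' PP']]; first by left.
by right; exists P' => //; exact: ih.
Qed.

Lemma descendants_le N M Q : (N <= M)%N -> descendants N Q `<=` descendants M Q.
Proof.
move=> /subnK <-; elim: (M - N)%N => [//|d ih].
by rewrite addSn; apply: subset_trans ih _; exact: descendantsS.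
Qed.

Lemma exhaustedS N Q : exhausted N Q `<=` exhausted N.+1 Q.
Proof.
elim: N Q => [|N ih] Q //= x [xQ|[P CP xP]]; first by left.
by right; exists P => //; exact: ih.
Qed.

Lemma exhausted_sub N Q : is_cube Q -> exhausted N Q `<=` hcube Q.
Proof.
elim: N Q => [|N ih] Q Q0 //= x [[]//|[P CP xP]].
have [_ /(_ _ CP)[cP _ PQ] _ _ _] := stepC Q0.
by apply: inner_hcube PQ _ _; exact: ih xP.
Qed.

Lemma measurable_exhausted N Q : is_cube Q -> measurable (exhausted N Q).
Proof.
elim: N Q => [|N ih] Q Q0 //=; apply: measurableU; first exact: measurable_leftover.
have [cC CP _ _ _] := stepC Q0.
by apply: measurable_countable_bigcup => // P /CP[cP _ _]; exact: ih.
Qed.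

(** Each generation covers at most half of the previous one. *)
Lemma leb_unexhausted N Q : is_cube Q ->
  ((2 ^+ N)%:E * mu (hcube Q `\` exhausted N Q) <= mu (hcube Q))%E.
Proof.
elim: N Q => [|N ih] Q Q0; first by rewrite expr0 mul1e setD0.
have [cC CP tC half _] := stepC Q0.
have mD P : C Q P -> measurable (hcube P `\` exhausted N P).
  by move=> /CP[cP _ _]; apply: measurableD; [exact: measurable_hcube|exact: measurable_exhausted].
apply: le_trans half; rewrite exprS EFinM -muleA lee_pmul2l//.
have sub : hcube Q `\` exhausted N.+1 Q `<=`
    \bigcup_(P in C Q) (hcube P `\` exhausted N P).
  move=> x [Qx nW]; have [[P CQP Px]|nP] := pselect ((\bigcup_(P in C Q) hcube P) x).
    by exists P => //; split => // Wx; apply: nW; right; exists P.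
  by exfalso; apply: nW; left.
apply: (@le_trans _ _ ((2 ^+ N)%:E * mu (\bigcup_(P in C Q) (hcube P `\` exhausted N P)))%E).
  apply: lee_pmul => //.
  apply: le_measure sub; rewrite inE; last exact: measurable_countable_bigcup.
  by apply: measurableD; [exact: measurable_hcube|exact: measurable_exhausted].
rewrite !measure_countable_bigcup//; last 2 first.
- by move=> P _; exact: measurable_hcube.
- by move=> P P' C1 C2 [x [[Px _] [P'x _]]]; apply: tC => //; exists x.
rewrite -ge0_esumZl ?exprn_ge0//; apply: le_esum => P /CP[cP _ _]; exact: ih.
Qed.

Lemma trivIset_children N Q : is_cube Q -> trivIset (C Q) (descendants N).
Proof.
move=> Q0 P P' CP CP' [P'' [PP PP']]; have [_ sub tC _ _] := stepC Q0.
have [cP _ _] := sub _ CP; have [cP' _ _] := sub _ CP'.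
have [cP'' _ i1] := descendantsP cP PP; have [_ _ i2] := descendantsP cP' PP'.
have [x xP''] := hcube_nonempty cP''.
by apply: tC => //; exists x; split; [exact: inner_hcube i1 _ xP''|exact: inner_hcube i2 _ xP''].
Qed.

(** The local estimate is applied with the exhausted parts of the children as
    the sets [Y P], and the remaining terms are the induction hypothesis. *)
Lemma integral_exhausted N Q : is_cube Q ->
  (\int[mu]_(x in exhausted N Q) h Q x <= \esum_(P in descendants N Q) a P)%E.
Proof.
elim: N Q => [|N ih] Q Q0 /=; first by rewrite integral_set0 esum_set0.
have [cC CP _ _ bound] := stepC Q0.
apply: le_trans (bound (exhausted N) _) _.
  move=> P /CP[cP _ _]; split; [exact: measurable_exhausted|exact: exhausted_sub].
rewrite [leRHS](esumID [set Q]); last first.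
  by move=> P /(descendantsP (N := N.+1) Q0)[cP _ _]; exact: a_ge0.
apply: leeD.
  rewrite (_ : _ `&` _ = [set Q]) ?esum_set1 ?a_ge0//.
  by apply/seteqP; split => [P []//|P ->]; split => //; left.
rewrite (_ : _ `&` _ = \bigcup_(P in C Q) descendants N P); last first.
  apply/seteqP; split => P; first by move=> [[->|//] []].
  move=> [P' CP' PP']; split; first by right; exists P'.
  exact: descendants_strict PP'.
rewrite esum_disjoint_bigcup; first last.
- move=> P P' /CP[cP _ _] /(descendantsP cP)[cP' _ _]; exact: a_ge0.
- exact: trivIset_children.
by apply: le_esum => P /CP[cP _ _]; exact: ih.
Qed.

(** A leftover avoids the children of its cube, hence the leftovers of all later
    generations. *)
Lemma trivIset_leftover N Q : is_cube Q -> trivIset (descendants N Q) leftover.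
Proof.
elim: N Q => [|N ih] Q Q0 //=.
have [_ CP tC _ _] := stepC Q0.
have away P P' : C Q P' -> descendants N P' P -> leftover P `<=` hcube P'.
  move=> CP' PP' x [Px _]; have [cP' _ _] := CP _ CP'.
  by have [_ _ /inner_hcube] := descendantsP cP' PP'; apply.
move=> P1 P2 [->|[P1' C1 D1]] [->|[P2' C2 D2]] // [x [x1 x2]].
- by case: x1 => _ []; exists P2' => //; exact: away x2.
- by case: x2 => _ []; exists P1' => //; exact: away x1.
- have P12 : P1' = P2'.
    by apply: tC => //; exists x; split; [exact: away x1|exact: away x2].
  rewrite -P12 in D2; have [cP _ _] := CP _ C1.
  by apply: (ih _ cP) => //; exists x.
Qed.

(** What is never exhausted is null, so the integrals over the exhausted sets
    increase to the integral over [Q]. Passing to the limit in this way bypasses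
    the last-generation terms, whose sizes are not known to tend to 0. *)
Lemma integral_hcube_le Q : is_cube Q ->
  (\int[mu]_(x in hcube Q) h Q x <= \esum_(P in \bigcup_N descendants N Q) a P)%E.
Proof.
move=> Q0; have mE N := measurable_exhausted N Q0.
have -> : (\int[mu]_(x in hcube Q) h Q x =
    \int[mu]_(x in \bigcup_N exhausted N Q) h Q x)%E.
  have sub : \bigcup_N exhausted N Q `<=` hcube Q.
    by move=> x [N _]; exact: exhausted_sub.
  have mU : measurable (\bigcup_N exhausted N Q) by exact: bigcup_measurable.
  rewrite -{1}(setDUK sub) ge0_integral_setU//=; last first.
  - by apply/disj_setPS => x [h1 [_ h2]].
  - exact: measurable_funTS (mh Q0).
  - by apply: measurableD => //; exact: measurable_hcube.
  rewrite [X in (_ + X)%E]null_set_integral ?adde0//.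
  - by apply: measurableD => //; exact: measurable_hcube.
  - exact: measurable_funTS (mh Q0).
  change (mu (hcube Q `\` \bigcup_N exhausted N Q) = 0%E).
  apply/eqP; rewrite eq_le measure_ge0 andbT.
  set z := mu _.
  have zN N : ((2 ^+ N)%:E * z <= mu (hcube Q))%E.
    apply: le_trans (leb_unexhausted N Q0); apply: lee_pmul => //; first exact: measure_ge0.
    apply: le_measure; rewrite ?inE.
    - by apply: measurableD => //; exact: measurable_hcube.
    - by apply: measurableD => //; exact: measurable_hcube.
    - by apply: setDS => x xN; exists N.
  have Qfin : mu (hcube Q) \is a fin_num by rewrite leb_hcube.
  have z1 := zN 0%N; rewrite expr0 mul1e in z1.
  have zy : (z < +oo)%E by apply: le_lt_trans z1 _; rewrite ltey_eq Qfin.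
  have zge0 : (0 <= z)%E by exact: measure_ge0.
  have zfin : z \is a fin_num by rewrite (ge0_fin_numE zge0).
  rewrite -(fineK zfin) lee_fin leNgt; apply/negP => z0.
  pose N := (Num.truncn (fine (mu (hcube Q)) / fine z)).+1.
  have := zN N; rewrite -(fineK zfin) -(fineK Qfin) -EFinM lee_fin leNgt => /negP; apply.
  rewrite -ltr_pdivrMr//; apply: lt_trans (truncnS_gt _) _.
  by rewrite -natrX ltr_nat ltn_expl.
have := @ge0_nondecreasing_set_cvg_integral _ _ _ (fun N => exhausted N Q) (h Q) mu.
have mono : {homo (fun N => exhausted N Q) : N M / (N <= M)%N >-> (N <= M)%O}.
  apply/nondecreasing_seqP => N; apply/subsetPset; exact: exhaustedS.
move=> /(_ mono mE (fun N => measurable_funTS (mh Q0)) (fun N x _ => h_ge0 Q x)) cv.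
rewrite -(cvg_lim _ cv)//; apply: lime_le; first by apply/cvg_ex; eexists; exact: cv.
near=> N; apply: le_trans (integral_exhausted N Q0) _.
apply: ge_ereal_sup => _ [A AS <-]; apply: ereal_sup_ubound; exists A => //.
by split; [exact: AS.1|apply: subset_trans AS.2 _ => P PN; exists N].
Unshelve. all: by end_near. Qed.

End iteration.

(** The set that a sparse family assigns to a cube depends on the cube alone, and
    not on the root [Q]: families below different roots can then be merged. *)
Lemma sparse_domination (h : cube_data -> Rn R n -> \bar R) (a : cube_data -> \bar R) :
  (forall Q x, 0 <= h Q x)%E ->
  (forall Q, is_cube Q -> measurable_fun setT (h Q)) ->
  (forall Q, is_cube Q -> 0 <= a Q)%E ->
  (forall Q, is_cube Q -> exists C, local_step h a Q C) ->
  exists E : cube_data -> set (Rn R n), forall Q, is_cube Q ->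
  exists S : set cube_data, [/\
    forall P, S P -> [/\ is_cube P, inner P Q, measurable (E P), E P `<=` hcube P &
                         (mu (hcube P) <= 2%:E * mu (E P))%E],
    trivIset S E &
    (\int[mu]_(x in hcube Q) h Q x <= \esum_(P in S) a P)%E].
Proof.
move=> h0 mh a0 step.
have [C stepC] : {C : cube_data -> set cube_data &
    forall Q, is_cube Q -> local_step h a Q (C Q)}.
  apply: (@choice _ _ (fun Q C => is_cube Q -> local_step h a Q C)) => Q.
  have [Q0|nQ0] := pselect (is_cube Q); last by exists set0.
  by have [C ?] := step Q Q0; exists C.
exists (leftover C) => Q Q0; exists (\bigcup_N descendants C N Q); split.
- move=> P [N _ PN]; have [cP _ PQ] := descendantsP stepC Q0 PN; split => //.
  + exact: measurable_leftover stepC _ cP.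
  + by move=> x [].
  + exact: leb_leftover stepC _ cP.
- move=> P P' [N _ PN] [M _ PM] PP'.
  apply: (trivIset_leftover stepC (N := maxn N M) Q0) => //.
    exact: descendants_le (leq_maxl _ _) _ PN.
  exact: descendants_le (leq_maxr _ _) _ PM.
- exact: integral_hcube_le.
Qed.

End sparse_iteration.

(** * Weak norms, averages and truncations *)

Section power_integrals.
Context d (T : measurableType d) (R : realType) (mu : {measure set T -> \bar R}).
Implicit Types (f : T -> R) (A B : set T) (p r : R).

Lemma measurable_abs_powR p f A : measurable_fun setT f ->
  measurable_fun A (fun x => (`|f x| `^ p)%:E).
Proof.
move=> mf; apply: measurable_funTS; apply/measurable_EFinP.
apply: (@measurableT_comp _ _ _ _ _ _ (@powR R ^~ p)) => //.
exact: measurableT_comp.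
Qed.

Lemma measurable_trunc f A : measurable_fun setT f -> measurable A ->
  measurable_fun setT (f \* \1_A).
Proof. by move=> mf mA; apply: measurable_funM => //; exact: measurable_indic. Qed.

Definition power_int (p : R) f A : \bar R := (\int[mu]_(x in A) (`|f x| `^ p)%:E)%E.

Lemma power_int_ge0 p f A : (0 <= power_int p f A)%E.
Proof. by apply: integral_ge0 => x _; rewrite lee_fin powR_ge0. Qed.

Lemma LnormE p f : ('N[mu]_p%:E[EFin \o f] = power_int p f setT `^ p^-1)%E.
Proof.
by rewrite unlock.
Qed.

Lemma Lfun_power_int p f : 0 < p -> f \in Lfun mu p%:E <->
  measurable_fun setT f /\ (power_int p f setT < +oo)%E.
Proof.
move=> p0; have pi0 : p^-1 != 0 by rewrite invr_neq0// gt_eqF.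
rewrite !inE /=; split.
  move=> /andP[/[!inE] mf] h; split => //.
  by apply: (lty_poweRy pi0); rewrite -LnormE; exact: h.
move=> [mf fy]; apply/andP; split; rewrite !inE//=.
by have := poweR_lty p^-1 fy; rewrite -LnormE.
Qed.

Lemma power_int_trunc p f A : 0 < p -> measurable A ->
  power_int p (f \* \1_A) setT = power_int p f A.
Proof.
move=> p0 mA; rewrite /power_int [RHS]integral_mkcond; apply: eq_integral => x _.
rewrite /patch /= indicE; case: ifPn => xA; rewrite ?mulr1// mulr0 normr0.
by rewrite powR0// gt_eqF.
Qed.

Lemma power_intS p f A B : measurable_fun setT f -> measurable A -> measurable B ->
  A `<=` B -> (power_int p f A <= power_int p f B)%E.
Proof.
move=> mf mA mB AB; apply: ge0_subset_integral => //.
exact: measurable_abs_powR.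
Qed.

Lemma trunc_Lfun p f A : 0 < p -> measurable_fun setT f -> measurable A ->
  (power_int p f A < +oo)%E -> f \* \1_A \in Lfun mu p%:E.
Proof.
move=> p0 mf mA fy; apply/(Lfun_power_int _ p0); split; first exact: measurable_trunc.
by rewrite power_int_trunc.
Qed.

(** Jensen's inequality up to a factor, by comparing [t^p] with
    [l^p + l^(p - r) t^r] at the level [l] of the larger average. *)
Lemma power_int_le p r f A (m a : R) : 1 <= p -> p <= r -> 0 < m -> 0 <= a ->
  measurable A -> measurable_fun setT f -> mu A = m%:E ->
  power_int r f A = (m * a `^ r)%:E ->
  (power_int p f A <= (m * (2 * a) `^ p)%:E)%E.
Proof.
move=> p1 pr m0 a0 mA mf Am fa.
have p0 : 0 < p by exact: lt_le_trans p1.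
have r0 : 0 < r by exact: lt_le_trans pr.
have bound (l : R) : 0 < l ->
    (power_int p f A <= (m * (l `^ p + l `^ (p - r) * a `^ r))%:E)%E.
  move=> l0.
  apply: (@le_trans _ _ (\int[mu]_(x in A) ((l `^ p)%:E +
      (l `^ (p - r))%:E * (`|f x| `^ r)%:E))%E).
    apply: ge0_le_integral => //.
    - exact: measurable_abs_powR.
    - apply: emeasurable_funD => //; apply: measurable_funeM.
      exact: measurable_abs_powR.
    - move=> x _; rewrite -EFinM -EFinD lee_fin; set t := `|f x|.
      have [tl|lt] := leP t l.
        apply: (@le_trans _ _ (l `^ p)); last by rewrite lerDl mulr_ge0// powR_ge0.
        by apply: ge0_ler_powR => //; rewrite ?nnegrE ?(ltW p0) ?(ltW l0) ?normr_ge0.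
      have t0 : 0 < t by exact: lt_trans lt.
      apply: (@le_trans _ _ (l `^ (p - r) * t `^ r)); last by rewrite lerDr powR_ge0.
      have -> : t `^ p = t `^ (p - r) * t `^ r.
        by rewrite -powRD ?subrK// gt_eqF// implybT.
      rewrite ler_wpM2r ?powR_ge0// -(opprB r p) !powRN.
      rewrite lef_pV2 ?posrE ?powR_gt0//.
      by apply: ge0_ler_powR; rewrite ?subr_ge0 ?nnegrE ?(ltW l0) ?(ltW t0) ?(ltW lt).
  have mfr : measurable_fun A (fun x => (`|f x| `^ r)%:E) by exact: measurable_abs_powR.
  have fr0 x : A x -> (0 <= (`|f x| `^ r)%:E)%E by rewrite lee_fin powR_ge0.
  have lr0 : (0 <= (l `^ (p - r))%:E)%E by rewrite lee_fin powR_ge0.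
  rewrite ge0_integralD//; [|by move=> x _; rewrite lee_fin powR_ge0|
    by move=> x Ax; exact: mule_ge0 lr0 (fr0 x Ax)|exact: measurable_funeM].
  rewrite integral_cst// ge0_integralZl_EFin ?powR_ge0//.
  rewrite -/(power_int r f _) fa Am -!EFinM -EFinD lee_fin.
  by rewrite mulrDr [m * (_ * _)]mulrCA [_ `^ p * _]mulrC.
have [a00|a00] := ltP 0 a.
  apply: le_trans (bound _ a00) _; rewrite lee_fin ler_pM2l//.
  rewrite -powRD ?subrK; last by rewrite gt_eqF// implybT.
  rewrite powRM// -mulr2n -[leLHS]mulr_natl ler_wpM2r ?powR_ge0//.
  by rewrite -[leLHS](@powRr1 _ 2)// ler_powR// ler1n.
(* When the larger average is 0 the level is free; it is chosen to make the
   bound equal to [e]. *)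
have aeq : a = 0 by apply/eqP; rewrite eq_le a00.
rewrite aeq mulr0 powR0 ?gt_eqF// mulr0; apply/lee_addgt0Pr => e e0.
rewrite add0e; have l0 : 0 < (e / m) `^ p^-1 by rewrite powR_gt0// divr_gt0.
apply: le_trans (bound _ l0) _; rewrite aeq powR0 ?gt_eqF// mulr0 addr0.
rewrite -powRrM mulVf ?gt_eqF// powRr1; last by rewrite divr_ge0 ?(ltW e0) ?(ltW m0).
by rewrite mulrC divfK ?gt_eqF.
Qed.

End power_integrals.

Section norms.
Context {R : realType} {n : nat}.
Local Notation V := 'rV[R]_n.+1.
Local Notation mu := (leb R n).
Local Notation cube_data := ('rV[R]_n.+1 * R)%type.
Implicit Types (x y : Rn R n) (Q P : cube_data) (f g : Rn R n -> R) (A : set (Rn R n)).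

Lemma ge0_itv (z : \bar R) : (0 <= z)%E -> z \in `[0%E, +oo%E].
Proof. by move=> z0; rewrite in_itv /= z0 leey. Qed.

(** At a positive level this is the definition of the weak norm. At level [0] the
    weak norm only controls the sets [d < |F|] with [d > 0], all of which are
    null here; their countable union is the support of [F], and subadditivity of
    the outer measure applies to it. Including level [0] makes degenerate
    averages no special case later on. *)
Lemma weak_norm_level (p c t : R) (F : Rn R n -> \bar R) :
  0 < p -> 0 <= c -> 0 <= t -> (weak_norm p F <= (c * t `^ p^-1)%:E)%E ->
  (@leb_outer R n [set x | c%:E < `|F x|] <= t%:E)%E.
Proof.
move=> p0 c0 t0 FB.
have pi0 : p^-1 != 0 by rewrite invr_neq0// gt_eqF.
have level (d : R) : 0 < d ->
    (d%:E * @leb_outer R n [set x | d%:E < `|F x|] `^ p^-1 <= (c * t `^ p^-1)%:E)%E.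
  by move=> d0; apply: le_trans FB; apply: ereal_sup_ubound; exists d.
have [c0'|c0'] := ltP 0 c.
  have := level c c0'; rewrite EFinM lee_pmul2l// => h.
  have nn A : (0 <= @leb_outer R n A)%E by exact: outer_measure_ge0.
  have root (z : \bar R) : (0 <= z)%E -> ((z `^ p^-1) `^ p)%E = z.
    by move=> z0; rewrite -poweRrM mulVf ?poweRe1// gt_eqF.
  rewrite -(root _ (nn _)) -(root t%:E)//.
  by apply: gt0_ler_poweR; rewrite ?(ltW p0)// ge0_itv// poweR_ge0.
have c00 : c = 0 by apply/eqP; rewrite eq_le c0'.
have null (d : R) : 0 < d -> @leb_outer R n [set x | d%:E < `|F x|]%E = 0%E.
  move=> d0; have := level d d0; rewrite c00 mul0r => h.
  apply: (@poweR_eq0_eq0 _ _ p^-1); first exact: outer_measure_ge0.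
  apply/eqP; rewrite eq_le poweR_ge0 andbT.
  by rewrite -(@lee_pmul2l _ d%:E)// mule0.
rewrite c00; apply: (@le_trans _ _ 0%E) => //.
pose G k : set (Rn R n) := [set x | (k.+1%:R^-1)%:E < `|F x|]%E.
have sub : [set x | 0%:E < `|F x|]%E `<=` \bigcup_k G k.
  move=> x /=; case Fx : (F x) => [z| |] /=; last 2 first.
  - by move=> _; exists 0%N => //=; rewrite /G /= Fx ltry.
  - by move=> _; exists 0%N => //=; rewrite /G /= Fx ltry.
  rewrite lte_fin => z0; exists (Num.truncn (`|z|^-1)) => //=.
  rewrite /G /= Fx lte_fin -[ltRHS]invrK ltf_pV2 ?posrE ?invr_gt0//.
  exact: truncnS_gt.
apply: (le_trans (le_outer_measure (@leb_outer R n) _ _ sub)).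
apply: (le_trans (outer_measure_sigma_subadditive (@leb_outer R n) G)).
by rewrite eseries0// => k _ _; apply: null.
Qed.

(** The infimum of the admissible constants of a bound is again admissible. *)
Lemma le_ereal_inf_mul (A : set R) (W X : \bar R) :
  (forall C, A C -> 0 <= C) -> (0 <= X)%E -> (X < +oo)%E ->
  (ereal_inf [set C%:E | C in A] < +oo)%E ->
  (forall C, A C -> (W <= C%:E * X)%E) ->
  (W <= ereal_inf [set C%:E | C in A] * X)%E.
Proof.
move=> A0 X0 Xy Ay AW.
have [_ [C AC _] _] := ereal_inf_lt Ay.
case: X X0 Xy AW => [x| |] // + _ AW; rewrite lee_fin le_eqVlt => /predU1P[x0|x0].
  by have := AW C AC; rewrite -x0 !mule0.
rewrite -lee_pdivrMr//; apply: le_ereal_inf_tmp => _ [C' AC' <-].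
by rewrite lee_pdivrMr//; exact: AW.
Qed.

Hypothesis vol_gt0 : 0 < @unit_vol R n.

Definition vol Q : R := unit_vol (R := R) (n := n) * Q.2 ^+ n.+1.

Lemma vol_pos Q : is_cube Q -> 0 < vol Q.
Proof. by move=> Q0; rewrite mulr_gt0// exprn_gt0. Qed.

Lemma avgE p f Q : is_cube Q ->
  avg p f Q = (((vol Q)^-1%:E * power_int mu p f (cube Q)) `^ p^-1)%E.
Proof.
move=> Q0; rewrite /avg leb_cube// inver ifN//.
by rewrite gt_eqF// vol_pos.
Qed.

Lemma avg_ge0 p f Q : (0 <= avg p f Q)%E.
Proof. exact: poweR_ge0. Qed.

Lemma avg_power_int p f Q : 0 < p -> is_cube Q ->
  power_int mu p f (cube Q) = ((vol Q)%:E * (avg p f Q) `^ p)%E.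
Proof.
move=> p0 Q0; have v0 := vol_pos Q0.
rewrite avgE// -poweRrM mulVf ?gt_eqF// poweRe1; last first.
  by rewrite mule_ge0 ?power_int_ge0// lee_fin invr_ge0 ltW.
by rewrite muleA -EFinM mulfV ?gt_eqF// mul1e.
Qed.

Lemma avg_le p r f Q : 1 <= p -> p <= r -> is_cube Q -> measurable_fun setT f ->
  (avg p f Q <= 2%:E * avg r f Q)%E.
Proof.
move=> p1 pr Q0 mf; have v0 := vol_pos Q0.
have p0 : 0 < p by exact: lt_le_trans p1.
have r0 : 0 < r by exact: lt_le_trans pr.
have [/eqP ry|ry] := boolP (avg r f Q == +oo%E).
  by rewrite ry gt0_muley ?lte_fin// leey.
have rfin : avg r f Q \is a fin_num.
  by rewrite (ge0_fin_numE (avg_ge0 _ _ _)) lt_neqAle ry leey.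
have [a a0 aE] : exists2 a, 0 <= a & avg r f Q = a%:E.
  by exists (fine (avg r f Q)); rewrite ?fineK// fine_ge0// avg_ge0.
have := @power_int_le _ _ _ mu p r f (cube Q) (vol Q) a p1 pr v0 a0
  (measurable_cube Q) mf (leb_cube Q0).
rewrite avg_power_int// aE poweR_EFin -EFinM => /(_ erefl) h.
have pn0 : p != 0 by rewrite gt_eqF.
have -> : (2%:E * a%:E = ((2 * a)%:E `^ p) `^ p^-1)%E.
  by rewrite -poweRrM mulfV// poweRe1// lee_fin mulr_ge0.
rewrite avgE//.
have pi0 : 0 <= p^-1 by rewrite invr_ge0 ltW.
apply: gt0_ler_poweR => //.
- by rewrite ge0_itv// mule_ge0 ?power_int_ge0// lee_fin invr_ge0 ltW.
- by rewrite ge0_itv// poweR_ge0.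
- by rewrite [leLHS]muleC lee_pdivrMr// poweR_EFin -EFinM [X in (_ <= X%:E)%E]mulrC.
Qed.

End norms.

(** * The local estimate *)

Section weighted_integrals.
Context d (T : measurableType d) (R : realType) (mu : {measure set T -> \bar R}).
Implicit Types (u v w g : T -> R) (A : set T).

Definition weighted u g A : \bar R := (\int[mu]_(x in A) (`|u x| * `|g x|)%:E)%E.

Lemma measurable_abs g A : measurable_fun setT g ->
  measurable_fun A (fun x => (`|g x|)%:E).
Proof.
by move=> mg; apply/measurable_EFinP/measurable_funTS; exact: measurableT_comp.
Qed.

Lemma measurable_weighted u g A : measurable_fun setT u -> measurable_fun setT g ->
  measurable_fun A (fun x => (`|u x| * `|g x|)%:E).
Proof.
move=> mu' mg; apply: measurable_funTS; apply/measurable_EFinP.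
by apply: measurable_funM; exact: measurableT_comp.
Qed.

Lemma weighted_le_ae u v w g A : measurable A ->
  measurable_fun setT u -> measurable_fun setT v -> measurable_fun setT w ->
  measurable_fun setT g -> {ae mu, forall x, `|u x| <= `|v x| + `|w x|} ->
  (weighted u g A <= weighted v g A + weighted w g A)%E.
Proof.
move=> mA mfu mfv mfw mfg uvw.
rewrite /weighted -ge0_integralD//; [|exact: measurable_weighted..].
apply: ae_ge0_le_integral => //.
- exact: measurable_weighted.
- by move=> x _; rewrite -EFinD lee_fin addr_ge0.
- by apply: emeasurable_funD; exact: measurable_weighted.
- apply: filterS uvw => x ux _; rewrite -EFinD lee_fin -mulrDl.
  by rewrite ler_wpM2r.
Qed.

Lemma weighted_le_cst u g A (c : R) : measurable A -> 0 <= c ->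
  measurable_fun setT u -> measurable_fun setT g ->
  (forall x, A x -> `|u x| <= c) ->
  (weighted u g A <= c%:E * \int[mu]_(x in A) (`|g x|)%:E)%E.
Proof.
move=> mA c0 mfu mfg uc.
have mg : measurable_fun A (fun x => (`|g x|)%:E) by exact: measurable_abs.
rewrite -ge0_integralZl_EFin//; apply: ge0_le_integral => //.
- exact: measurable_weighted.
- exact: measurable_funeM.
- by move=> x Ax; rewrite -EFinM lee_fin ler_wpM2r// uc.
Qed.

Lemma weightedS u g A B : measurable A -> measurable B ->
  measurable_fun setT u -> measurable_fun setT g -> A `<=` B ->
  (weighted u g A <= weighted u g B)%E.
Proof.
move=> mA mB mfu mfg AB; apply: ge0_subset_integral => //.
exact: measurable_weighted.
Qed.

End weighted_integrals.

Section local_estimate.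
Context {R : realType} {n : nat}.
Local Notation V := 'rV[R]_n.+1.
Local Notation mu := (leb R n).
Local Notation cube_data := ('rV[R]_n.+1 * R)%type.
Local Notation vol := (@vol R n).
Implicit Types (x y : Rn R n) (Q P : cube_data).

Lemma integral_hcube Q (k : Rn R n -> \bar R) : is_cube Q ->
  measurable_fun setT k -> (forall x, 0 <= k x)%E ->
  (\int[mu]_(x in hcube Q) k x = \int[mu]_(x in cube Q) k x)%E.
Proof.
move=> Q0 mk k0.
have mc := measurable_cube Q; have mh := measurable_hcube Q.
have mD : measurable (hcube Q `\` cube Q) by exact: measurableD.
have kc A : measurable_fun A k by exact: measurable_funTS.
rewrite -{1}(setDUK (@sub_cube_hcube _ _ Q)).
rewrite (ge0_integral_setU mu mc mD (kc _) (fun x _ => k0 x)); last first.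
  by apply/disj_setPS => x [h1 [_ h2]].
by rewrite (null_set_integral mD (kc _) (leb_hcubeD Q0)) adde0.
Qed.

Hypothesis vol_gt0 : 0 < @unit_vol R n.

Lemma Lnorm_trunc p (f : Rn R n -> R) Q : 0 < p -> is_cube Q ->
  ('N[mu]_p%:E[EFin \o (f \* \1_(cube Q))%R] = (vol Q `^ p^-1)%:E * avg p f Q)%E.
Proof.
move=> p0 Q0; rewrite LnormE power_int_trunc//; last exact: measurable_cube.
rewrite avg_power_int// poweRM ?poweR_ge0//; last by rewrite lee_fin ltW// vol_pos.
by rewrite poweR_EFin -poweRrM mulfV ?gt_eqF// poweRe1// avg_ge0.
Qed.

Lemma powR_root_scale (c v p : R) : 1 <= c -> 0 <= v -> 1 <= p ->
  (c * v) `^ p^-1 <= c * v `^ p^-1.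
Proof.
move=> c1 v0 p1; rewrite powRM//; last exact: le_trans c1.
rewrite ler_wpM2r ?powR_ge0// ler1_powR// invf_le1//; exact: lt_le_trans p1.
Qed.

Lemma is_cube_triple Q : is_cube Q -> is_cube (triple Q).
Proof. by move=> Q0; rewrite /is_cube mulr_gt0. Qed.

Lemma vol_triple Q : vol (triple Q) = 3 ^+ n.+1 * vol Q.
Proof. by rewrite /vol /= exprMn mulrCA. Qed.

(** Two exceptional sets of measure at most [delta * |Q|] have an open hull of
    measure at most [2 ^+ n.+1 * 3 * delta * |Q|], and stopping in [Q] asks that
    [2 ^+ n.+3] times this be at most [|Q|]. *)
Definition delta : R := (4 ^+ n.+3)^-1.

(** The factor [3 ^+ n.+1] is the ratio of the measures of [3 Q] and [Q], the
    factor 2 is that of [avg_le], and the two factors [delta^-1] bound the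
    powers of [delta^-1] with exponents [1 / r] and [1 / s] (or [1 / q]), which
    are at most 1. *)
Definition level_cst : R := 2 * 3 ^+ n.+1 / delta ^+ 2.

Lemma delta_gt0 : 0 < delta. Proof. by rewrite invr_gt0 exprn_gt0. Qed.

Lemma delta_le1 : delta <= 1.
Proof. by rewrite invf_le1 ?exprn_gt0// exprn_ege1// ler1n. Qed.

Lemma level_cst_gt0 : 0 < level_cst.
Proof. by rewrite divr_gt0 ?mulr_gt0 ?exprn_gt0// delta_gt0. Qed.

Variables (q r s nu : R) (D : set (Rn R n -> R)) (T : (Rn R n -> R) -> Rn R n -> R).
Hypotheses (q1 : 1 <= q) (qr : q <= r) (s1 : 1 <= s) (nuE : nu^-1 = r^-1 + s^-1).
Hypothesis Dr : forall f, f \in Lfun mu r%:E -> D f.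
Hypothesis subT : sublinear_operator D T.
Variables (NT NM : R).
Hypotheses (NT0 : 0 <= NT) (NM0 : 0 <= NM).
Hypothesis boundT : forall F, F \in Lfun mu q%:E ->
  (weak_norm q (EFin \o T F) <= NT%:E * 'N[mu]_q%:E[EFin \o F])%E.
Hypothesis boundM : forall F G, F \in Lfun mu r%:E -> G \in Lfun mu s%:E ->
  (weak_norm nu (maximal_operator T F G)
     <= NM%:E * ('N[mu]_r%:E[EFin \o F] * 'N[mu]_s%:E[EFin \o G]))%E.
Variables (f g : Rn R n -> R).
Hypothesis fLr : f \in Lfun mu r%:E.
Hypothesis mg : measurable_fun setT g.
Hypothesis gloc : forall Q, is_cube Q -> (power_int mu s g (cube Q) < +oo)%E.

Let q0 : 0 < q. Proof. exact: lt_le_trans q1. Qed.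
Let r1 : 1 <= r. Proof. exact: le_trans qr. Qed.
Let r0 : 0 < r. Proof. exact: lt_le_trans r1. Qed.
Let s0 : 0 < s. Proof. exact: lt_le_trans s1. Qed.
Let nu0 : 0 < nu. Proof. by rewrite -invr_gt0 nuE addr_gt0// invr_gt0. Qed.
Let mf : measurable_fun setT f.
Proof. by have /(Lfun_power_int _ _ r0)[] := fLr. Qed.

Definition favg Q : R := fine (avg r f (triple Q)).
Definition gavg Q : R := fine (avg s g Q).

Lemma avg_fin p (k : Rn R n -> R) Q : 0 < p -> is_cube Q ->
  (power_int mu p k (cube Q) < +oo)%E -> avg p k Q \is a fin_num.
Proof.
move=> p0 Q0 ky; rewrite (ge0_fin_numE (avg_ge0 _ _ _)) avgE//.
apply: poweR_lty; rewrite lte_mul_pinfty// lee_fin invr_ge0 ltW//.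
exact: vol_pos.
Qed.

Lemma f_cube_fin Q : (power_int mu r f (cube Q) < +oo)%E.
Proof.
have /(Lfun_power_int _ _ r0)[_] := fLr; apply: le_lt_trans.
by apply: power_intS; [exact: mf|exact: measurable_cube|exact: measurableT|].
Qed.

Lemma favgE Q : is_cube Q -> avg r f (triple Q) = (favg Q)%:E.
Proof.
move=> Q0; rewrite fineK//; apply: avg_fin => //; first exact: is_cube_triple.
exact: f_cube_fin.
Qed.

Lemma gavgE Q : is_cube Q -> avg s g Q = (gavg Q)%:E.
Proof. by move=> Q0; rewrite fineK//; apply: avg_fin => //; exact: gloc. Qed.

Lemma favg_ge0 Q : 0 <= favg Q. Proof. by rewrite fine_ge0// avg_ge0. Qed.
Lemma gavg_ge0 Q : 0 <= gavg Q. Proof. by rewrite fine_ge0// avg_ge0. Qed.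

Lemma f_trunc_Lr A : measurable A -> f \* \1_A \in Lfun mu r%:E.
Proof.
move=> mA; apply: trunc_Lfun => //.
have /(Lfun_power_int _ _ r0)[_] := fLr; apply: le_lt_trans.
by apply: power_intS; [exact: mf|exact: mA|exact: measurableT|].
Qed.

Lemma f_trunc_Lq Q : is_cube Q -> f \* \1_(cube (triple Q)) \in Lfun mu q%:E.
Proof.
move=> Q0; have tQ0 := is_cube_triple Q0.
apply: trunc_Lfun; [exact: q0|exact: mf|exact: measurable_cube|].
rewrite avg_power_int// lte_mul_pinfty//; first by rewrite lee_fin ltW// vol_pos.
apply: poweR_lty; apply: (le_lt_trans (avg_le vol_gt0 q1 qr tQ0 mf)).
by rewrite favgE// -EFinM ltry.
Qed.

(** The weak type of [T] bounds this by an average of exponent [q], which Jensen's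
    inequality replaces by one of exponent [r]. *)
Lemma T_level Q : is_cube Q ->
  (@leb_outer R n [set x | (level_cst * NT * favg Q < `|T (f \* \1_(cube (triple Q))) x|)%R]
     <= (delta * vol Q)%:E)%E.
Proof.
move=> Q0; have tQ0 := is_cube_triple Q0; have v0 := vol_pos vol_gt0 Q0.
have d0 := delta_gt0.
have -> : [set x | level_cst * NT * favg Q < `|T (f \* \1_(cube (triple Q)))%R x|] =
    [set x | (level_cst * NT * favg Q)%:E < `|(EFin \o T (f \* \1_(cube (triple Q)))%R) x|]%E.
  by [].
have l0 := ltW level_cst_gt0.
apply: (weak_norm_level (p := q)) => //.
- exact: mulr_ge0 (mulr_ge0 l0 NT0) (favg_ge0 Q).
- by rewrite mulr_ge0 ?ltW.
apply: (le_trans (boundT (f_trunc_Lq Q0))).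
rewrite Lnorm_trunc//.
apply: (@le_trans _ _ (NT%:E * ((vol (triple Q) `^ q^-1)%:E * (2 * favg Q)%:E))%E).
  rewrite lee_wpmul2l// lee_wpmul2l ?lee_fin ?powR_ge0//.
  by rewrite EFinM -favgE//; exact: avg_le.
rewrite -!EFinM lee_fin.
have -> : vol (triple Q) = (3 ^+ n.+1 / delta) * (delta * vol Q).
  by rewrite vol_triple [RHS]mulrA divfK// gt_eqF.
have c1 : 1 <= 3 ^+ n.+1 / delta.
  by rewrite ler_pdivlMr// mul1r (le_trans delta_le1)// exprn_ege1// ler1n.
have := powR_root_scale c1 (ltW (mulr_gt0 d0 v0)) q1.
set X := _ `^ _; set W := _ `^ q^-1 => XW.
have W0 : 0 <= W by exact: powR_ge0.
have la : 2 * (3 ^+ n.+1 / delta) <= level_cst.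
  rewrite /level_cst expr2 invfM !mulrA ler_peMr ?divr_ge0 ?mulr_ge0 ?exprn_ge0 ?(ltW d0)//.
  by rewrite invf_ge1// delta_le1.
apply: (@le_trans _ _ (NT * ((3 ^+ n.+1 / delta * W) * (2 * favg Q)))).
  by rewrite ler_wpM2l// ler_wpM2r// mulr_ge0// favg_ge0.
have -> : NT * ((3 ^+ n.+1 / delta * W) * (2 * favg Q)) =
  2 * (3 ^+ n.+1 / delta) * (NT * favg Q * W) by ring.
have -> : level_cst * NT * favg Q * W = level_cst * (NT * favg Q * W) by ring.
by rewrite ler_wpM2r// !mulr_ge0// favg_ge0.
Qed.

(** The same for the maximal operator. The identity [1/nu = 1/r + 1/s] makes the
    powers of [|Q|] on both sides agree. *)
Lemma M_level Q : is_cube Q ->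
  (@leb_outer R n [set x | (level_cst * NM * favg Q * gavg Q)%:E <
     `|maximal_operator T (f \* \1_(cube (triple Q)))%R (g \* \1_(cube Q))%R x|]%E
     <= (delta * vol Q)%:E)%E.
Proof.
move=> Q0; have tQ0 := is_cube_triple Q0; have v0 := vol_pos vol_gt0 Q0.
have d0 := delta_gt0.
have l0 := ltW level_cst_gt0.
apply: (weak_norm_level (p := nu)) => //.
- exact: mulr_ge0 (mulr_ge0 (mulr_ge0 l0 NM0) (favg_ge0 Q)) (gavg_ge0 Q).
- by rewrite mulr_ge0 ?ltW.
have gL : g \* \1_(cube Q) \in Lfun mu s%:E.
  by apply: trunc_Lfun; [exact: s0|exact: mg|exact: measurable_cube|exact: gloc].
apply: (le_trans (boundM (f_trunc_Lr (measurable_cube _)) gL)).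
rewrite !Lnorm_trunc// favgE// gavgE// -!EFinM lee_fin.
have -> : vol (triple Q) = (3 ^+ n.+1 / delta) * (delta * vol Q).
  by rewrite vol_triple [RHS]mulrA divfK// gt_eqF.
have {2}-> : vol Q = delta^-1 * (delta * vol Q).
  by rewrite [RHS]mulrA mulVf ?mul1r// gt_eqF.
have c1 : 1 <= 3 ^+ n.+1 / delta.
  by rewrite ler_pdivlMr// mul1r (le_trans delta_le1)// exprn_ege1// ler1n.
have c2 : 1 <= delta^-1 by rewrite invf_ge1// delta_le1.
have e0 := mulr_gt0 d0 v0.
have := powR_root_scale c1 (ltW e0) r1.
have := powR_root_scale c2 (ltW e0) s1.
rewrite nuE powRD; last by rewrite (gt_eqF e0) implybT.
set X := _ `^ _; set W := _ `^ s^-1; set X' := _ `^ r^-1; set W' := _ `^ r^-1 => XW XW'.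
have W0 : 0 <= W by exact: powR_ge0.
have W0' : 0 <= W' by exact: powR_ge0.
have X0 : 0 <= X by exact: powR_ge0.
have X0' : 0 <= X' by exact: powR_ge0.
have la : (3 ^+ n.+1 / delta) * delta^-1 <= level_cst.
  rewrite /level_cst expr2 invfM -!mulrA ler_peMl ?ler1n//.
  by rewrite !mulr_ge0 ?exprn_ge0 ?invr_ge0 ?(ltW d0).
have XX : X' * X <= level_cst * (W' * W).
  apply: (@le_trans _ _ ((3 ^+ n.+1 / delta * W') * (delta^-1 * W))).
    by apply: ler_pM.
  rewrite mulrACA; by rewrite ler_wpM2r// mulr_ge0.
have -> : NM * (X' * favg Q * (X * gavg Q)) = (X' * X) * (NM * favg Q * gavg Q) by ring.
have -> : level_cst * NM * favg Q * gavg Q * (W' * W) =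
  level_cst * (W' * W) * (NM * favg Q * gavg Q) by ring.
by rewrite ler_wpM2r// !mulr_ge0// ?favg_ge0 ?gavg_ge0.
Qed.


Definition local_mass Q x : \bar R :=
  (`|T (f \* \1_(cube (triple Q)))%R x| * `|g x|)%:E.

Definition local_bound Q : \bar R :=
  (2 * level_cst * (NT + NM) * favg Q * gavg Q * vol Q)%:E.

Let mT F : D F -> measurable_fun setT (T F).
Proof. by case: subT => _ + _ _; apply. Qed.

Let mTf A : measurable A -> measurable_fun setT (T (f \* \1_A)).
Proof. by move=> mA; apply: mT; apply: Dr; exact: f_trunc_Lr. Qed.

Lemma leb_hcubeE_vol Q : is_cube Q -> mu (hcube Q) = (vol Q)%:E.
Proof. exact: leb_hcube. Qed.

(** The set on which [T] or the maximal operator exceeds its level, enlarged to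
    an open set so that it admits stopping cubes. *)
Lemma exceptional_set Q : is_cube Q -> exists O : set (Rn R n),
  [/\ measurable O,
      forall x, O x -> exists2 d : R, 0 < d &
        forall y, (forall i, `|(y : V) ord0 i - (x : V) ord0 i| < d) -> O y,
      ((2 ^+ n.+3)%:E * mu O <= mu (hcube Q))%E,
      forall x, ~ O x -> `|T (f \* \1_(cube (triple Q))) x| <= level_cst * NT * favg Q &
      forall x, ~ O x -> (`|maximal_operator T (f \* \1_(cube (triple Q)))%R
          (g \* \1_(cube Q))%R x| <= (level_cst * NM * favg Q * gavg Q)%:E)%E].
Proof.
move=> Q0; have v0 := vol_pos vol_gt0 Q0; have d0 := delta_gt0.
set E1 := [set x | level_cst * NT * favg Q < `|T (f \* \1_(cube (triple Q))) x|].
set E2 := [set x | (level_cst * NM * favg Q * gavg Q)%:E <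
     `|maximal_operator T (f \* \1_(cube (triple Q)))%R (g \* \1_(cube Q))%R x|]%E.
have E12 : (@leb_outer R n (E1 `|` E2) < (3 * (delta * vol Q))%:E)%E.
  apply: (le_lt_trans (outer_measureU2 _ _ _)).
  apply: (le_lt_trans (leeD (T_level Q0) (M_level Q0))).
  by rewrite -EFinD lte_fin; have := mulr_gt0 d0 v0; lra.
have [ O [mO EO OE openO]] := open_hull E12.
exists O; split => //.
- rewrite leb_hcubeE_vol//.
  apply: (@le_trans _ _ ((2 ^+ n.+3)%:E * (2 ^+ n.+1 * (3 * (delta * vol Q)))%:E)%E).
    by rewrite lee_wpmul2l// lee_fin exprn_ge0.
  rewrite -EFinM lee_fin.
  have -> : 2 ^+ n.+3 * (2 ^+ n.+1 * (3 * (delta * vol Q))) =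
    (2 ^+ n.+3 * 2 ^+ n.+1 * 3 * delta) * vol Q by ring.
  rewrite ler_piMl ?(ltW v0)// /delta ler_pdivrMr ?exprn_gt0// mul1r.
  have -> : 4 = 2 * 2 :> R by ring.
  rewrite exprMn -mulrA ler_pM2l ?exprn_gt0// [leRHS]exprSr [in leRHS]exprSr -mulrA.
  by rewrite ler_pM2l ?exprn_gt0//; lra.
- move=> x nO; rewrite leNgt; apply/negP => h; apply: nO; apply: EO; left; exact: h.
- move=> x nO; rewrite leNgt; apply/negP => h; apply: nO; apply: EO; right; exact: h.
Qed.

(** The splitting that moves from a cube [Q] to its child [P]: the first term is
    the part of [f] that the maximal operator sees, the second is what [P] deals
    with. *)
Lemma trunc_split P Q : cube (triple P) `<=` cube (triple Q) ->
  (f \* \1_(cube (triple Q)) \* \1_(~` cube (triple P))) \+ f \* \1_(cube (triple P)) =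
  f \* \1_(cube (triple Q)).
Proof.
move=> PQ; apply/funext => x /=; rewrite !indicE in_setC.
have [xP|xP] := boolP (x \in cube (triple P)).
  by rewrite /= mulr0 add0r mem_set//; apply: PQ; exact: set_mem.
by rewrite /= !mulr1 mulr0 addr0.
Qed.

Lemma inner_cube P Q : inner P Q -> cube P `<=` cube Q.
Proof.
move=> PQ x; rewrite !cubeE => xP i; have := xP i; have := PQ i.
rewrite ler_norml; lra.
Qed.

(** At a point of [P] outside the exceptional set, the maximal operator controls
    the contribution to [P] of the part of [f] far from [P]. *)
Lemma far_part P Q x (c : R) : is_cube P -> inner P Q -> cube P x -> 0 <= c ->
  (`|maximal_operator T (f \* \1_(cube (triple Q)))%R (g \* \1_(cube Q))%R x| <= c%:E)%E ->
  (weighted mu (T (f \* \1_(cube (triple Q)) \* \1_(~` cube (triple P)))%R) g (hcube P)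
     <= c%:E * mu (hcube P))%E.
Proof.
move=> P0 PQ xP c0 Mc; have v0 := vol_pos vol_gt0 P0.
have mF : measurable_fun setT (T (f \* \1_(cube (triple Q)) \* \1_(~` cube (triple P)))).
  apply: mT; apply: Dr; apply: trunc_Lfun; [exact: r0| | |].
  - by apply: measurable_trunc; [exact: mf|exact: measurable_cube].
  - by apply: measurableC; exact: measurable_cube.
  - have /(Lfun_power_int _ _ r0)[mFQ] := f_trunc_Lr (measurable_cube (triple Q)).
    apply: le_lt_trans; apply: power_intS; [exact: mFQ| |exact: measurableT|by []].
    by apply: measurableC; exact: measurable_cube.
rewrite /weighted (integral_hcube P0 (measurable_weighted (A := setT) mF mg));
  last by move=> y; rewrite lee_fin mulr_ge0.
have vM : ((mu (cube P))^-1 * \int[mu]_(y in cube P)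
    (`|T (f \* \1_(cube (triple Q)) \* \1_(~` cube (triple P)))%R y|
       * `|(g \* \1_(cube Q))%R y|)%:E <= c%:E)%E.
  apply: le_trans Mc; apply: le_trans (lee_abs _).
  by apply: ereal_sup_ubound; exists P.
rewrite leb_hcubeE_vol// -lee_pdivrMr// muleC; apply: le_trans vM.
rewrite leb_cube// inver ifN ?gt_eqF// le_eqVlt; apply/orP; left; apply/eqP.
congr (_ * _)%E; apply: eq_integral => y yP.
rewrite /= [in RHS]indicE [in RHS]mem_set ?mulr1//; exact: inner_cube PQ _ (set_mem yP).
Qed.

Lemma gavg_integral Q : is_cube Q ->
  (\int[mu]_(x in hcube Q) (`|g x|)%:E <= (2 * gavg Q * vol Q)%:E)%E.
Proof.
move=> Q0; have v0 := vol_pos vol_gt0 Q0.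
have mabs : measurable_fun setT (fun x => (`|g x|)%:E) by exact: measurable_abs.
rewrite (integral_hcube Q0 mabs); last by move=> x; rewrite lee_fin.
have -> : (\int[mu]_(x in cube Q) (`|g x|)%:E = power_int mu 1 g (cube Q))%E.
  by apply: eq_integral => x _; rewrite powRr1.
rewrite avg_power_int// poweRe1 ?avg_ge0// muleC [leRHS]EFinM lee_wpmul2r//.
  by rewrite lee_fin ltW.
by rewrite EFinM -gavgE//; exact: avg_le.
Qed.

(** On the part of [Q] without stopping cubes [T] stays below its level. On a
    stopping cube [P], sublinearity splits off the far part of [f], which is
    controlled at some point of [P] outside the exceptional set. *)
Lemma local_step_holds Q : is_cube Q -> exists C, local_step local_mass local_bound Q C.
Proof.
move=> Q0; have v0 := vol_pos vol_gt0 Q0.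
have [ O [mO openO small TO MO]] := exceptional_set Q0.
have [cC CP tC cover] := stopping_cubesP vol_gt0 Q0 mO openO small.
set C := stopping_cubes O Q in cC CP tC cover.
have mP P : measurable (hcube P) by exact: measurable_hcube.
have mU : measurable (\bigcup_(P in C) hcube P) by exact: measurable_countable_bigcup.
have half : (2%:E * mu (\bigcup_(P in C) hcube P) <= mu (hcube Q))%E.
  apply: le_trans small; rewrite exprS EFinM -muleA lee_pmul2l//.
  rewrite measure_countable_bigcup//.
  apply: (@le_trans _ _ (\esum_(P in C) ((2 ^+ n.+2)%:E * mu (hcube P `&` O)))%E).
    by apply: le_esum => P /CP[_ _ _ hP _]; exact: ltW.
  rewrite ge0_esumZl ?exprn_ge0//.
  have mPO P : C P -> measurable (hcube P `&` O) by move=> _; exact: measurableI.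
  rewrite -(@measure_countable_bigcup _ _ _ _ mu C (fun P => hcube P `&` O) cC)//.
  - rewrite lee_wpmul2l ?lee_fin ?exprn_ge0//; apply: le_measure; rewrite ?inE.
    + exact: measurable_countable_bigcup cC mPO.
    + exact: mO.
    + by move=> x [P _ []].
  - by move=> P P' CP1 CP2 [x [[x1 _] [x2 _]]]; apply: tC => //; exists x.
exists C; split => //; first by move=> P /CP[P0 le PQ _ _].
move=> Y YP; have mYP P CPP := (YP P CPP).1; have sYP P CPP := (YP P CPP).2.
have mTQ := mTf (measurable_cube (triple Q)).
have mass0 x : (0 <= local_mass Q x)%E by rewrite lee_fin mulr_ge0.
have mmass A : measurable_fun A (local_mass Q) by exact: measurable_weighted mTQ mg.
have mYU : measurable (\bigcup_(P in C) Y P) by exact: measurable_countable_bigcup cC mYP.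
have mL : measurable (hcube Q `\` \bigcup_(P in C) hcube P) by exact: measurableD.
rewrite (ge0_integral_setU mu mL mYU (mmass _) (fun x _ => mass0 x)); last first.
  apply/disj_setPS => x [[_ nU] [P CPP Yx]]; apply: nU; exists P => //.
  exact: sYP Yx.
have tY : trivIset C Y.
  move=> P P' C1 C2 [x [x1 x2]]; apply: tC => //; exists x.
  by split; [exact: sYP x1|exact: sYP x2].
rewrite (integral_countable_bigcup _ cC tY mYP (mmass setT) mass0).
have l0 := ltW level_cst_gt0.
set c1 := level_cst * NT * favg Q; set c2 := level_cst * NM * favg Q * gavg Q.
have c10 : 0 <= c1 by exact: mulr_ge0 (mulr_ge0 l0 NT0) (favg_ge0 Q).
have c20 : 0 <= c2.
  exact: mulr_ge0 (mulr_ge0 (mulr_ge0 l0 NM0) (favg_ge0 Q)) (gavg_ge0 Q).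
have near_part : (\int[mu]_(x in hcube Q `\` \bigcup_(P in C) hcube P) local_mass Q x
    <= c1%:E * (2 * gavg Q * vol Q)%:E)%E.
  have TL x : (hcube Q `\` \bigcup_(P in C) hcube P) x ->
      `|T (f \* \1_(cube (triple Q))) x| <= c1.
    by move=> [Qx nU]; apply: TO => Ox; apply: nU; exact: cover.
  apply: (le_trans (weighted_le_cst mu mL c10 mTQ mg TL)).
  rewrite lee_wpmul2l ?lee_fin//; apply: le_trans (gavg_integral Q0).
  apply: ge0_subset_integral; [exact: mL|exact: mP| | |].
  - exact: measurable_abs.
  - by move=> x _; rewrite lee_fin.
  - by move=> x [].
have far P : C P -> (\int[mu]_(x in Y P) local_mass Q x <=
    \int[mu]_(x in Y P) local_mass P x + c2%:E * mu (hcube P))%E.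
  move=> CPP; have [P0 le PQ _ [x [xP nOx]]] := CP P CPP.
  have PQ2 : P.2 <= Q.2.
    by apply: le_trans le _; rewrite ler_pdivrMr// mulr2n mulrDr mulr1 lerDl ltW.
  have PQ3 := inner_cube_triple PQ2 PQ.
  have mTP := mTf (measurable_cube (triple P)).
  have DF : D (f \* \1_(cube (triple Q)) \* \1_(~` cube (triple P))).
    apply: Dr; apply: trunc_Lfun; [exact: r0| | |].
    - by apply: measurable_trunc; [exact: mf|exact: measurable_cube].
    - by apply: measurableC; exact: measurable_cube.
    - have /(Lfun_power_int _ _ r0)[mFQ] := f_trunc_Lr (measurable_cube (triple Q)).
      apply: le_lt_trans; apply: power_intS; [exact: mFQ| |exact: measurableT|by []].
      by apply: measurableC; exact: measurable_cube.
  have DP : D (f \* \1_(cube (triple P))) by apply: Dr; exact: f_trunc_Lr (measurable_cube _).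
  have [_ _ sub _] := subT.
  have := sub _ _ DF DP; rewrite trunc_split// => ae.
  apply: (le_trans (weighted_le_ae (mYP P CPP) mTQ (mT DF) mTP mg ae)).
  rewrite addeC; apply: leeD; last exact: lexx.
  apply: le_trans (far_part P0 PQ xP c20 (MO x nOx)).
  by have := weightedS mu (mYP P CPP) (mP P) (mT DF) mg (sYP P CPP); apply.
apply: (le_trans (leeD near_part (le_esum far))).
have esum_nonneg P : C P -> (0 <= \int[mu]_(x in Y P) local_mass P x)%E.
  by move=> _; apply: integral_ge0 => x _; rewrite lee_fin mulr_ge0.
rewrite esumD//; last by move=> P _; rewrite mule_ge0.
rewrite addeA addeAC; apply: leeD; last exact: lexx.
rewrite ge0_esumZl// -measure_countable_bigcup//.
have Uv : (mu (\bigcup_(P in C) hcube P) <= (vol Q)%:E)%E.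
  rewrite -leb_hcubeE_vol//; apply: le_measure; rewrite ?inE.
  - exact: mU.
  - exact: mP.
  - by move=> x [P /CP[_ _ PQ _ _] xP]; exact: inner_hcube PQ _ xP.
apply: (@le_trans _ _ (c1%:E * (2 * gavg Q * vol Q)%:E + c2%:E * (vol Q)%:E)%E).
  by apply: leeD => //; rewrite lee_wpmul2l// lee_fin.
rewrite -!EFinM -EFinD /local_bound lee_fin.
have -> : 2 * level_cst * (NT + NM) * favg Q * gavg Q * vol Q =
    c1 * (2 * gavg Q * vol Q) + c2 * vol Q + c2 * vol Q by rewrite /c1 /c2; ring.
by rewrite lerDl mulr_ge0// ltW.
Qed.

End local_estimate.

(** * A partition of space adapted to the support *)

Section triadic_roots.
Context {R : realType} {n : nat}.
Local Notation V := 'rV[R]_n.+1.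
Local Notation cube_data := ('rV[R]_n.+1 * R)%type.
Implicit Types (x y : Rn R n) (Q P : cube_data).
Variable L : R.
Hypothesis L0 : 0 < L.

Definition shell_cube (j : nat) (v : 'I_n.+1 -> int) : cube_data :=
  (\row_i ((v i)%:~R * (2 * (3 ^+ j * L))), 2 * (3 ^+ j * L)).

(** The cubes of shell [j] tile the cube of side [2 * 3^(j+1) L] with the one of
    side [2 * 3^j L] removed; shell 0 contains the central cube as well. They grow with the distance to the origin, so that
    the triple of each of them still contains the central cube. *)
Definition root_cubes : set cube_data :=
  [set Q | exists j (v : {ffun 'I_n.+1 -> int}),
    [/\ Q = shell_cube j v, forall i, `|v i| <= 1 &
        j = 0%N \/ exists i, v i != 0]].

Lemma shell_gt0 j : 0 < 3 ^+ j * L.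
Proof. by rewrite mulr_gt0// exprn_gt0. Qed.

Lemma is_cube_roots Q : root_cubes Q -> is_cube Q.
Proof.
by move=> [j [v [-> _ _]]]; rewrite /is_cube /= mulr_gt0// shell_gt0.
Qed.

Lemma countable_roots : countable root_cubes.
Proof.
pose F (km : nat * {ffun 'I_n.+1 -> int}) := shell_cube km.1 km.2.
apply: (@sub_countable _ _ _ (F @` setT)); last first.
  by apply: sub_countable (card_image_le _ _) _; exact: countableP.
by apply: subset_card_le => _ [j [v [-> _ _]]]; exists (j, v).
Qed.

Lemma int_abs1 (m : int) : `|m| <= 1 -> [\/ m = 0, m = 1 | m = -1].
Proof.
by case: m => [[|[|m]]|[|m]] //= _; [constructor 1|constructor 2|constructor 3].
Qed.

Lemma shell_cubeP j v x : hcube (shell_cube j v) x <-> forall i,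
  (v i)%:~R * (2 * (3 ^+ j * L)) - 3 ^+ j * L <= (x : V) ord0 i
    < (v i)%:~R * (2 * (3 ^+ j * L)) + 3 ^+ j * L.
Proof.
have E : 2 * (3 ^+ j * L) / 2 = 3 ^+ j * L by rewrite mulrAC mulfV ?mul1r.
by rewrite /hcube /=; split => h i; have := h i; rewrite !mxE E.
Qed.

Lemma shell_disjoint j k v w x : (j < k)%N -> (forall i, `|v i| <= 1) ->
  (forall i, `|w i| <= 1) -> (exists i, w i != 0) ->
  hcube (shell_cube j v) x -> hcube (shell_cube k w) x -> False.
Proof.
move=> jk v1 w1 [i wi] /shell_cubeP/(_ i) xv /shell_cubeP/(_ i) xw.
have le : 3 * (3 ^+ j * L) <= 3 ^+ k * L.
  by rewrite mulrA -exprS ler_wpM2r ?(ltW L0)// ler_eXn2l// ltr1n.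
have := shell_gt0 j; have := shell_gt0 k.
move: le xv xw; set a := 3 ^+ j * L; set b := 3 ^+ k * L => le.
case: (int_abs1 (w1 i)) wi => -> // _; case: (int_abs1 (v1 i)) => ->;
  rewrite ?mulr0z ?mulr1z ?mulrN1z; lra.
Qed.

Lemma trivIset_roots : trivIset root_cubes hcube.
Proof.
move=> _ _ [j [v [-> v1 vj]]] [k [w [-> w1 wk]]] [x [xv xw]].
case: (ltngtP j k) => [jk|kj|jk].
- case: wk => [k0|wk]; first by rewrite k0 in jk.
  by case: (shell_disjoint jk v1 w1 wk xv xw).
- case: vj => [j0|vj]; first by rewrite j0 in kj.
  by case: (shell_disjoint kj w1 v1 vj xw xv).
- rewrite -jk in xw *; suff -> : v = w by [].
  apply/ffunP => i; move: xv xw => /shell_cubeP/(_ i) + /shell_cubeP/(_ i).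
  have := shell_gt0 j; set a := 3 ^+ j * L => a0.
  by case: (int_abs1 (v1 i)) => ->; case: (int_abs1 (w1 i)) => ->;
    rewrite ?mulr0z ?mulr1z ?mulrN1z => h1 h2 //; exfalso; clear - a0 h1 h2; lra.
Qed.

Lemma roots_cover : \bigcup_(Q in root_cubes) hcube Q = setT.
Proof.
apply/seteqP; split => // x _.
have ex : exists j, [forall i, - (3 ^+ j * L) <= (x : V) ord0 i < 3 ^+ j * L].
  pose j := (Num.truncn (`|(x : V)| / L)).+1; exists j; apply/forallP => i.
  have : `|(x : V)| < 3 ^+ j * L.
    rewrite -ltr_pdivrMr//; apply: lt_trans (truncnS_gt _) _.
    by rewrite -natrX ltr_nat ltn_expl.
  move/(le_lt_trans (le_abs_coord_mx _ i)); rewrite ltr_norml => /andP[h1 h2].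
  by rewrite h2 (ltW h1).
(* If the cube of side [2 * 3^(j+1) L] is the first of its kind to contain [x],
   then [x] lies in shell [j]. *)
case: (ex_minnP ex) => -[|j] /forallP xj minj.
  exists (shell_cube 0 [ffun=> 0]).
    by exists 0%N, [ffun=> 0]; split => //; [move=> i; rewrite ffunE|left].
  by apply/shell_cubeP => i; rewrite ffunE mul0r !add0r; exact: xj.
pose a := 3 ^+ j * L.
pose v := [ffun i : 'I_n.+1 => if (x : V) ord0 i < - a then -1 : int
  else if (x : V) ord0 i < a then 0 else 1].
have a0 : 0 < a by exact: shell_gt0.
have xv i : [\/ (x : V) ord0 i < - a /\ v i = -1,
    - a <= (x : V) ord0 i < a /\ v i = 0 | a <= (x : V) ord0 i /\ v i = 1].
  rewrite /v ffunE; case: ltP => h1; first by constructor 1.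
  by case: ltP => h2; [constructor 2|constructor 3].
exists (shell_cube j v).
  exists j, v; split => //; first by move=> i; case: (xv i) => -[_ ->].
  right; apply: contrapT => /forallNP vi.
  have : (j.+1 <= j)%N; last by rewrite ltnn.
  apply: minj; apply/forallP => i.
  by case: (xv i) => -[h vE] //; exfalso; apply: (vi i); rewrite vE.
apply/shell_cubeP => i; have := xj i; rewrite exprS -mulrA -/a.
by case: (xv i) => -[h ->]; rewrite ?mulr0z ?mulr1z ?mulrN1z; lra.
Qed.

Lemma roots_triple Q x : root_cubes Q -> (forall i, `|(x : V) ord0 i| < L) ->
  cube (triple Q) x.
Proof.
move=> [j [v [-> v1 _]]] xL; rewrite cubeE => i /=; rewrite mxE.
have E : 3 * (2 * (3 ^+ j * L)) / 2 = 3 * (3 ^+ j * L) by field.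
rewrite E; have := xL i; rewrite ltr_norml.
have : L <= 3 ^+ j * L by rewrite ler_peMl ?(ltW L0)// exprn_ege1// ler1n.
by case: (int_abs1 (v1 i)) => ->; rewrite ?mulr0z ?mulr1z ?mulrN1z; lra.
Qed.

End triadic_roots.

(** * The sparse bound *)

Lemma power_int_ae0 d (T : measurableType d) (R : realType)
    (mu : {measure set T -> \bar R}) (p : R) (F : T -> R) :
  0 < p -> measurable_fun setT F -> {ae mu, forall x, F x = 0} ->
  power_int mu p F setT = 0%E.
Proof.
move=> p0 mF F0; rewrite /power_int.
rewrite (ae_eq_integral (cst 0%E)) ?integral0//; first exact: measurable_abs_powR.
by apply: filterS F0 => x -> _ /=; rewrite normr0 powR0// gt_eqF.
Qed.

Section reduction.
Context {R : realType} {n : nat}.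
Local Notation V := 'rV[R]_n.+1.
Local Notation mu := (leb R n).
Local Notation cube_data := ('rV[R]_n.+1 * R)%type.
Implicit Types (x y : Rn R n) (Q P : cube_data).


Lemma negligible_leb_outer (A : set (Rn R n)) : @leb_outer R n A = 0%E -> mu.-negligible A.
Proof.
move=> A0; exists A; split => //.
apply: le_caratheodory_measurable => X.
have le0 : (@leb_outer R n (X `&` A) <= 0)%E.
  by rewrite -A0; apply: le_outer_measure; exact: subIsetr.
apply: (@le_trans _ _ (0 + @leb_outer R n X)%E); last by rewrite add0e.
by apply: leeD => //; apply: le_outer_measure; exact: subIsetl.
Qed.

Lemma compact_ccube Q : compact (ccube Q : set V).
Proof.
rewrite (_ : (ccube Q : set V) = [set v : V | forall i,
    (`[Q.1 ord0 i - Q.2 / 2, Q.1 ord0 i + Q.2 / 2]%classic : set R) (v ord0 i)]).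
  apply: (@rV_compact R n.+1 (fun i =>
    `[Q.1 ord0 i - Q.2 / 2, Q.1 ord0 i + Q.2 / 2]%classic)) => i.
  exact: segment_compact.
by apply/seteqP; split => x xQ i; have := xQ i; rewrite /= in_itv.
Qed.

Lemma Lp_loc_cube (s : R) (g : Rn R n -> R) Q : Lp_loc s g ->
  (power_int mu s g (cube Q) < +oo)%E.
Proof.
move=> [mg /(_ _ (@compact_ccube Q))]; apply: le_lt_trans.
apply: power_intS; [exact: mg|exact: measurable_cube|exact: measurable_ccube|].
by move=> x /sub_cube_hcube /sub_hcube_ccube.
Qed.

Lemma compact_in_cube (K : set V) : compact K -> exists2 L : R, 0 < L &
  forall x, K x -> forall i, `|x ord0 i| < L.
Proof.
move=> /compact_bounded[M [_ MK]].
exists (Num.max M 0 + 2); first by rewrite ltr_wpDl// le_max lexx orbT.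
move=> x Kx i; apply: (le_lt_trans (le_abs_coord_mx x i)).
apply: (@le_lt_trans _ _ (Num.max M 0 + 1)); last by rewrite ltrD2l ltr1n.
by apply: (MK (Num.max M 0 + 1) _ x Kx); rewrite ltr_pwDr// le_max lexx.
Qed.

Hypothesis vol_gt0 : 0 < @unit_vol R n.
Variables (q r s nu : R) (D : set (Rn R n -> R)) (T : (Rn R n -> R) -> Rn R n -> R).
Hypotheses (q1 : 1 <= q) (qr : q <= r) (s1 : 1 <= s).
Hypothesis Dr : forall f, f \in Lfun mu r%:E -> D f.
Hypothesis subT : sublinear_operator D T.
Variables (NT NM : R).
Hypotheses (NT0 : 0 <= NT) (NM0 : 0 <= NM).
Hypothesis boundT : forall F, F \in Lfun mu q%:E ->
  (weak_norm q (EFin \o T F) <= NT%:E * 'N[mu]_q%:E[EFin \o F])%E.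
Variables (f g : Rn R n -> R).
Hypothesis fLr : f \in Lfun mu r%:E.
Hypothesis gloc : Lp_loc s g.

Let q0 : 0 < q. Proof. exact: lt_le_trans q1. Qed.
Let r1 : 1 <= r. Proof. exact: le_trans qr. Qed.
Let r0 : 0 < r. Proof. exact: lt_le_trans r1. Qed.
Let s0 : 0 < s. Proof. exact: lt_le_trans s1. Qed.

(** Sublinearity alone does not give this: that [T] respects null sets comes from
    its weak type. *)
Lemma T_ae0 (F : Rn R n -> R) : measurable_fun setT F ->
  {ae mu, forall x, F x = 0} -> {ae mu, forall x, T F x = 0}.
Proof.
move=> mF F0; have I0 := power_int_ae0 q0 mF F0.
have FL : F \in Lfun mu q%:E.
  by apply/(Lfun_power_int _ _ q0); split; [exact: mF|rewrite I0 ltry].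
have := boundT FL; rewrite LnormE I0 poweR0r ?invr_neq0 ?gt_eqF// mule0 => TF.
have : (@leb_outer R n [set x | 0%:E < `|(EFin \o T F) x|]%E <= 0%:E)%E.
  apply: (weak_norm_level (p := q)) => //; apply: (le_trans TF).
  by rewrite mul0r.
move=> h; have : @leb_outer R n [set x | 0%:E < `|(EFin \o T F) x|]%E = 0%E.
  by apply/eqP; rewrite eq_le h outer_measure_ge0.
move=> /negligible_leb_outer; apply: negligibleS => x /= TFx.
by rewrite lte_fin normr_gt0; apply/eqP.
Qed.

(** When [3 Q] contains the essential support, [f] differs from its restriction
    to [3 Q] by a function that vanishes almost everywhere. *)
Lemma T_le_trunc Q (K : set V) : {ae mu, forall x : Rn R n, ~ K x -> f x = 0} ->
  (forall x, K x -> cube (triple Q) (x : Rn R n)) ->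
  {ae mu, forall x, `|T f x| <= `|T (f \* \1_(cube (triple Q))) x| + `|cst 0 x : R|}.
Proof.
move=> f0 KQ; have mc := measurable_cube (triple Q).
have /(Lfun_power_int _ _ r0)[mf fy] := fLr.
have trL A : measurable A -> f \* \1_A \in Lfun mu r%:E.
  move=> mA; apply: trunc_Lfun; [exact: r0|exact: mf|exact: mA|].
  by apply: le_lt_trans fy; apply: power_intS; [exact: mf|exact: mA|exact: measurableT|].
have mC : measurable (~` cube (triple Q)) by exact: measurableC.
have [_ _ sub _] := subT.
have fE : (f \* \1_(cube (triple Q))) \+ (f \* \1_(~` cube (triple Q))) = f.
  apply/funext => x /=; rewrite !indicE in_setC -mulrDr.
  by case: (x \in _) => /=; rewrite ?addr0 ?add0r mulr1.
have := sub _ _ (Dr (trL _ mc)) (Dr (trL _ mC)); rewrite fE => Tsub.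
have far0 : {ae mu, forall x, T (f \* \1_(~` cube (triple Q))) x = 0}.
  apply: T_ae0; first exact: measurable_trunc mf mC.
  apply: filterS f0 => x fx /=; rewrite indicE in_setC.
  have [xQ|xQ] := boolP (x \in cube (triple Q)); first by rewrite /= mulr0.
  rewrite fx ?mul0r// => Kx; move/negP: xQ; apply; apply: mem_set; exact: KQ.
by apply: filterS2 Tsub far0 => x + E; rewrite E.
Qed.

(** The family of the theorem consists of the triples: [f] is already averaged
    over them, and averaging [g] over [3 P] in place of [P] gains in volume what
    it loses in the average, since [1 / s <= 1]. *)
Lemma local_bound_le P : is_cube P ->
  (local_bound r s NT NM f g P <= (2 * @level_cst R n * (NT + NM))%:E *
     (avg r f (triple P) * avg s g (triple P) * mu (cube (triple P))))%E.
Proof.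
move=> P0; have tP0 := is_cube_triple P0.
have gfin Q : is_cube Q -> avg s g Q = (gavg s g Q)%:E.
  by move=> Q0; exact: (gavgE vol_gt0 s1 (fun Q _ => Lp_loc_cube Q gloc) Q0).
rewrite (favgE vol_gt0 q1 qr fLr P0) gfin// leb_cube// -!EFinM lee_fin.
rewrite -/(vol (triple P)) vol_triple.
have v0 := vol_pos vol_gt0 P0; have v0' := vol_pos vol_gt0 tP0.
have three : 1 <= 3 ^+ n.+1 :> R by rewrite exprn_ege1// ler1n.
have three0 : 0 < 3 ^+ n.+1 :> R by rewrite exprn_gt0.
have gle : gavg s g P <= 3 ^+ n.+1 * gavg s g (triple P).
  rewrite -lee_fin EFinM -!gfin// !avgE// -(@poweRe1 _ (3 ^+ n.+1)%:E); last first.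
    by rewrite lee_fin ltW.
  have -> : ((3 ^+ n.+1)%:E `^ 1 = ((3 ^+ n.+1)%:E `^ s) `^ s^-1 :> \bar R)%E.
    by rewrite -poweRrM mulfV// gt_eqF.
  have I0 A : (0 <= power_int mu s g A)%E by exact: power_int_ge0.
  have c0 : (0 <= (vol (triple P))^-1%:E :> \bar R)%E by rewrite lee_fin invr_ge0 ltW.
  rewrite -poweRM ?poweR_ge0 ?mule_ge0//.
  apply: gt0_ler_poweR; rewrite ?invr_ge0 ?(ltW s0) ?ge0_itv ?mule_ge0 ?poweR_ge0//.
    by rewrite lee_fin invr_ge0 ltW.
  rewrite poweR_EFin muleA -EFinM; apply: lee_pmul => //.
  - by rewrite lee_fin invr_ge0 ltW.
  - rewrite lee_fin vol_triple [in leRHS]invfM [leRHS]mulrA ler_peMl ?invr_ge0 ?(ltW v0)//.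
    rewrite ler_pdivlMr// mul1r -[leLHS]powRr1 ?(ltW three0)//.
    by rewrite ler_powR.
  - apply: power_intS; [exact: gloc.1|exact: measurable_cube|exact: measurable_cube|].
    by move=> x; rewrite !cubeE => xP i; have := xP i; have : 0 < P.2 := P0; rewrite /=; lra.
set c := 2 * _ * _; have c0 : 0 <= c.
  by rewrite mulr_ge0 ?addr_ge0// mulr_ge0// ltW// level_cst_gt0.
set F := favg r f P; have F0 : 0 <= F by exact: favg_ge0.
have -> : c * (F * gavg s g (triple P) * (3 ^+ n.+1 * vol P)) =
  c * F * vol P * (3 ^+ n.+1 * gavg s g (triple P)) by ring.
have -> : c * F * gavg s g P * vol P = c * F * vol P * gavg s g P by ring.
exact: ler_wpM2l (mulr_ge0 (mulr_ge0 c0 F0) (ltW v0)) _ _ gle.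
Qed.

End reduction.

Theorem theorem3p1 (R : realType) (n : nat) :
  exists2 Cn : R, 0 < Cn &
  forall (q r s nu : R) (D : set (Rn R n -> R))
    (T : (Rn R n -> R) -> Rn R n -> R),
    1 <= q -> q <= r -> 1 <= s -> nu^-1 = r^-1 + s^-1 ->
    (forall f, f \in Lfun (leb R n) q%:E -> D f) ->
    (forall f, f \in Lfun (leb R n) r%:E -> D f) ->
    sublinear_operator D T ->
    weak_type q T ->
    (maximal_operator_norm r s nu T < +oo)%E ->
  forall f g : Rn R n -> R,
    f \in Lfun (leb R n) r%:E -> compactly_supported f -> Lp_loc s g ->
  exists S : set ('rV[R]_n.+1 * R),
    sparse (2 * 3 ^+ n.+1)^-1 S /\
    (`|pairing (T f) g|
      <= Cn%:E * (weak_type_norm q T + maximal_operator_norm r s nu T)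
         * \esum_(Q in S) (avg r f Q * avg s g Q * leb R n (cube Q)))%E.
Proof.
exists (2 * @level_cst R n).
  by rewrite mulr_gt0// level_cst_gt0.
move=> q r s nu D T q1 qr s1 nuE Dq Dr subT wT wM f g fLr [K cK f0] gloc.
have r1 : 1 <= r by exact: le_trans qr.
have q0 : 0 < q by exact: lt_le_trans q1.
have r0 : 0 < r by exact: lt_le_trans r1.
have s0 : 0 < s by exact: lt_le_trans s1.
have [_ mT _ _] := subT.
have mTf : measurable_fun setT (T f) by apply: mT; exact: Dr.
have mg := gloc.1.
have mTfg : measurable_fun setT (fun x => (T f x * g x)%:E).
  by apply/measurable_EFinP; exact: measurable_funM.
(* In this degenerate case the whole measure vanishes. *)
have [vol0|vol_neq0] := eqVneq (@unit_vol R n) 0.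
  exists set0; split; first by split => //; exists (fun=> set0); split => // ? ? [].
  rewrite esum_set0 mule0 /pairing.
  by rewrite (null_set_integral (@measurableT _ _) mTfg (leb_setT_eq0 vol0)) abse0.
have vol_gt0 : 0 < @unit_vol R n by rewrite lt_neqAle eq_sym vol_neq0 unit_vol_ge0.
have Lnorm_fin p (F : Rn R n -> R) : 0 < p -> F \in Lfun (leb R n) p%:E ->
    ('N[leb R n]_p%:E[EFin \o F] < +oo)%E.
  by move=> p0 /(Lfun_power_int _ _ p0)[_ Fy]; rewrite LnormE poweR_lty.
(* Both norms are finite and attained, so they serve as the constants of the
   local estimate. *)
have [NT NT0 NTE] : exists2 NT : R, 0 <= NT & weak_type_norm q T = NT%:E.
  have h0 : (0 <= weak_type_norm q T)%E.
    by apply: le_ereal_inf_tmp => _ [C [C0 _] <-]; rewrite lee_fin.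
  have hfin : weak_type_norm q T \is a fin_num by rewrite ge0_fin_numE.
  by exists (fine (weak_type_norm q T)); rewrite ?fineK// fine_ge0.
have [NM NM0 NME] : exists2 NM : R, 0 <= NM & maximal_operator_norm r s nu T = NM%:E.
  have h0 : (0 <= maximal_operator_norm r s nu T)%E.
    by apply: le_ereal_inf_tmp => _ [C [C0 _] <-]; rewrite lee_fin.
  have hfin : maximal_operator_norm r s nu T \is a fin_num by rewrite ge0_fin_numE.
  by exists (fine (maximal_operator_norm r s nu T)); rewrite ?fineK// fine_ge0.
have boundT F : F \in Lfun (leb R n) q%:E ->
    (weak_norm q (EFin \o T F) <= NT%:E * 'N[leb R n]_q%:E[EFin \o F])%E.
  move=> FL; rewrite -NTE; apply: le_ereal_inf_mul => //.
  - by move=> C [].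
  - exact: Lnorm_ge0.
  - exact: Lnorm_fin.
  - by move=> C [_ CF]; exact: CF.
have boundM F G : F \in Lfun (leb R n) r%:E -> G \in Lfun (leb R n) s%:E ->
    (weak_norm nu (maximal_operator T F G) <=
      NM%:E * ('N[leb R n]_r%:E[EFin \o F] * 'N[leb R n]_s%:E[EFin \o G]))%E.
  move=> FL GL; rewrite -NME; apply: le_ereal_inf_mul => //.
  - by move=> C [].
  - by apply: mule_ge0; exact: Lnorm_ge0.
  - by apply: lte_mul_pinfty; [exact: Lnorm_ge0| |exact: Lnorm_fin];
      rewrite ge0_fin_numE ?Lnorm_ge0//; exact: Lnorm_fin.
  - by move=> C [_ CFG]; rewrite muleA; exact: CFG.
have gcube Q (_ : is_cube Q) := @Lp_loc_cube R n s g Q gloc.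
pose h := local_mass T f g; pose a := local_bound r s NT NM f g.
have mtr Q : measurable_fun setT (T (f \* \1_(cube (triple Q)))).
  apply: mT; apply: Dr; exact: (f_trunc_Lr q1 qr fLr (measurable_cube _)).
have h0 Q x : (0 <= h Q x)%E by rewrite lee_fin mulr_ge0.
have mh Q : is_cube Q -> measurable_fun setT (h Q).
  by move=> _; exact: measurable_weighted (mtr Q) mg.
have a0 Q : is_cube Q -> (0 <= a Q)%E.
  move=> Q0; rewrite lee_fin.
  have := mulr_ge0 (mulr_ge0 (mulr_ge0 (mulr_ge0 (mulr_ge0 (ler0n R 2) (ltW (@level_cst_gt0 R n)))
    (addr_ge0 NT0 NM0)) (favg_ge0 r f Q)) (gavg_ge0 s g Q)) (ltW (vol_pos vol_gt0 Q0)).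
  by [].
have step Q (Q0 : is_cube Q) :=
  local_step_holds vol_gt0 q1 qr s1 nuE Dr subT NT0 NM0 boundT boundM fLr mg gcube Q0.
have [E sparseE] := sparse_domination h0 mh a0 step.
pose good Q (SQ : set ('rV[R]_n.+1 * R)) :=
  [/\ forall P, SQ P -> [/\ is_cube P, inner P Q, measurable (E P), E P `<=` hcube P &
                             (leb R n (hcube P) <= 2%:E * leb R n (E P))%E],
      trivIset SQ E &
      (\int[leb R n]_(x in hcube Q) h Q x <= \esum_(P in SQ) a P)%E].
have [S SP] : {S : 'rV[R]_n.+1 * R -> set ('rV[R]_n.+1 * R) &
    forall Q, is_cube Q -> good Q (S Q)}.
  apply: (@choice _ _ (fun Q SQ => is_cube Q -> good Q SQ)) => Q.
  have [Q0|nQ0] := pselect (is_cube Q); last by exists set0.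
  by have [SQ ?] := sparseE Q Q0; exists SQ.
(* Roots: a partition into cubes whose triples all contain the support. *)
have [L L0 KL] := compact_in_cube cK.
have rootQ (Q : 'rV[R]_n.+1 * R) : root_cubes L Q -> is_cube Q by exact: is_cube_roots.
pose SS := \bigcup_(Q in root_cubes L) S Q.
have cubeS Q P : root_cubes L Q -> S Q P -> is_cube P.
  by move=> /rootQ Q0 SQP; have [/(_ P SQP)[]] := SP Q Q0.
have innerS Q P : root_cubes L Q -> S Q P -> hcube P `<=` hcube Q.
  by move=> /rootQ Q0 SQP; have [/(_ P SQP)[_ /inner_hcube]] := SP Q Q0.
have subE Q P : root_cubes L Q -> S Q P -> E P `<=` hcube P.
  by move=> /rootQ Q0 SQP; have [/(_ P SQP)[]] := SP Q Q0.
have tS : trivIset (root_cubes L) S.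
  move=> Q Q' rQ rQ' [P [SP1 SP2]].
  have [x xP] := hcube_nonempty (cubeS Q P rQ SP1).
  by apply: (trivIset_roots L0) => //; exists x; split;
    [exact: innerS rQ SP1 _ xP|exact: innerS rQ' SP2 _ xP].
have tE : trivIset SS E.
  move=> P P' [Q rQ SQP] [Q' rQ' SQP'] [x [xP xP']].
  have QQ' : Q = Q'.
    apply: (trivIset_roots L0) => //; exists x; split.
      exact: innerS rQ SQP _ (subE Q P rQ SQP _ xP).
    exact: innerS rQ' SQP' _ (subE Q' P' rQ' SQP' _ xP').
  rewrite -QQ' in SQP'; have [_ tQ _] := SP Q (rootQ Q rQ).
  by apply: tQ => //; exists x.
(* The set assigned to a triple is that of the original cube: it keeps half of a
   cube [3 ^+ n.+1] times smaller. *)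
exists (@triple R n @` SS); split.
  split; first by move=> _ [P [Q rQ SQP] <-]; apply: is_cube_triple; exact: cubeS SQP.
  pose shrink (P : 'rV[R]_n.+1 * R) := (P.1, P.2 / 3).
  have shrinkK P : shrink (triple P) = P.
    by rewrite /shrink /= mulrAC mulfV ?mul1r// -surjective_pairing.
  exists (E \o shrink); split.
    move=> _ [P [Q rQ SQP] <-]; rewrite /comp shrinkK.
    have [/(_ P SQP)[P0 _ mE EP half] _ _] := SP Q (rootQ Q rQ).
    split => //.
      move=> x /EP xP; rewrite cubeE => i; have := xP i; have : 0 < P.2 := P0.
      by rewrite /=; lra.
    rewrite leb_cube ?is_cube_triple// -/(vol _) vol_triple -EFinM.
    move: half; rewrite leb_hcubeE_vol// muleC -lee_pdivrMr// -EFinM.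
    congr (_ <= _)%E; congr EFin; field.
    by rewrite expf_neq0.
  move=> _ _ [P SP1 <-] [P' SP2 <-]; rewrite /comp !shrinkK => h'.
  by congr triple; exact: tE.
have triple_inj : {in [set: 'rV[R]_n.+1 * R] &, injective (@triple R n)}.
  move=> [c1 l1] [c2 l2] _ _ [-> /mulfI ->//]; by rewrite pnatr_eq0.
rewrite NTE NME -EFinD -EFinM.
rewrite esum_image; last first.
  by move=> x y _ _; apply: triple_inj; exact: in_setT.
have avg3_ge0 P : (0 <= avg r f (triple P) * avg s g (triple P) * leb R n (cube (triple P)))%E.
  by rewrite !mule_ge0 ?avg_ge0//; exact: measure_ge0.
have C0 : 0 <= 2 * @level_cst R n * (NT + NM).
  by rewrite mulr_ge0 ?addr_ge0// mulr_ge0// ltW// level_cst_gt0.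
rewrite -ge0_esumZl//.
apply: (@le_trans _ _ (\esum_(P in SS) a P)); last first.
  apply: le_esum => P [Q rQ SQP].
  exact: (local_bound_le vol_gt0 q1 qr s1 NT0 NM0 fLr gloc (cubeS Q P rQ SQP)).
rewrite esum_disjoint_bigcup//; last first.
  by move=> Q P rQ SQP; apply: a0; exact: cubeS SQP.
have mW : measurable_fun setT (fun x => (`|T f x| * `|g x|)%:E).
  exact: measurable_weighted mTf mg.
apply: (le_trans (le_abse_integral _ (@measurableT _ _) mTfg)).
have -> : (\int[leb R n]_x `|(T f x * g x)%:E| =
    \int[leb R n]_(x in \bigcup_(Q in root_cubes L) hcube Q) (`|T f x| * `|g x|)%:E)%E.
  rewrite roots_cover//; apply: eq_integral => x _.
  by rewrite /= normrM.
have mhc (Q : 'rV[R]_n.+1 * R) : root_cubes L Q -> measurable (hcube Q) by move=> _; exact: measurable_hcube.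
rewrite (integral_countable_bigcup _ (countable_roots L) (trivIset_roots L0) mhc mW);
  last by move=> x; rewrite lee_fin mulr_ge0.
apply: le_esum => Q rQ; have Q0 := rootQ Q rQ.
have [_ _ hQ] := SP Q Q0; apply: le_trans hQ.
have KQ x : K x -> cube (triple Q) (x : Rn R n).
  by move=> Kx; apply: (roots_triple L0 rQ) => i; exact: KL.
have mz : measurable_fun setT (cst 0 : Rn R n -> R) by exact: measurable_cst.
have := weighted_le_ae (mhc Q rQ) mTf (mtr Q) mz mg
  (T_le_trunc q1 qr Dr subT boundT fLr f0 KQ).
have -> : weighted (leb R n) (cst 0) g (hcube Q) = 0%E.
  by apply: integral0_eq => x _; rewrite normr0 mul0r.
by rewrite adde0.
Qed.
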